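(* Let $G$ be a compact Lie group and let $\mathcal{U}$ be a $G$-universe. The functors $\alpha$ (from $G$-spectra to $G\mathcal{U}$-spectra) and $\beta$ (from $G\mathcal{U}$-spectra to $G$-spectra) are adjoint equivalences of categories.
   Context: Spaces are compactly generated weak Hausdorff; $G\mathrm{Top}_*$ is the category of based $G$-spaces and based equivariant maps. A $G$-spectrum $X$ is a sequence of pointed $G\times O(n)$-spaces $X_n$, $n\ge 0$, with $G\times O(p)\times O(q)$-equivariant structure maps $\nu_{p,q}: S^p\wedge X_q\to X_{p+q}$, where $S^p$ is the one-point compactification of $\mathbb{R}^p$ (based at infinity, trivial $G$-action, standard $O(p)$-action), such that $\nu_{0,q}$ is the identity and $\nu_{p,q+r}\circ(1\wedge\nu_{q,r})=\nu_{p+q,r}\circ(\mu_{p,q}\wedge 1)$, with $\mu_{p,q}:S^p\wedge S^q\cong S^{p+q}$ the standard isomorphism. Maps are sequences of $G\times O(n)$-equivariant based maps compatible with the structure maps. A $G$-universe $\mathcal{U}$ is a set of finite-dimensional orthogonal $G$-representations closed under finite direct sums and summands and containing the one-dimensional trivial representation. $O(V,W)$ is the space of linear isometric isomorphisms $V\to W$, with $G$ acting by conjugation. View $\mathcal{U}$ as a category enriched over pointed $G$-spaces with $\mathcal{U}(V,W)=O(V,W)_+$ if $\dim V=\dim W$ and $*$ otherwise. A $G\mathcal{U}$-spectrum is an enriched functor $X$ from $\mathcal{U}$ to pointed $G$-spaces (so there are pointed $G$-spaces $X(V)$ and associative, unital $G$-maps $O(V,W)_+\wedge X(V)\to X(W)$)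 together with an associative and unital natural transformation of $G$-functors on $\mathcal{U}\times\mathcal{U}$, $S^V\wedge X(W)\to X(V\oplus W)$, where $S^V$ is the one-point compactification of $V$. Maps of $G\mathcal{U}$-spectra are families of based $G$-maps $X(V)\to Y(V)$ compatible with all this structure. The functor $\beta$: $(\beta X)_n=X(\mathbb{R}^n)$ ($\mathbb{R}^n$ with trivial $G$-action), with $O(n)=O(\mathbb{R}^n,\mathbb{R}^n)$ acting by functoriality, and structure maps those of $X$ restricted to $V=\mathbb{R}^p$, $W=\mathbb{R}^q$. The functor $\alpha$: $(\alpha X)(V)=O(\mathbb{R}^n,V)_+\wedge_{O(n)}X_n$ for $n=\dim V$, with diagonal $G$-action; equivalently $(\alpha X)(V)=X_n$ with $g\cdot x=\rho(g)(gx)=g(\rho(g)x)$, where $\rho:G\to O(n)$ corresponds to $V$. With this identification, $O(V,W)_+\wedge(\alpha X)(V)\to(\alpha X)(W)$ is $(\tau,x)\mapsto\tau x$ for $\tau\in O(V,W)=O(n)$, and the structure maps $S^V\wedge(\alpha X)(W)\to(\alpha X)(V\oplus W)$ are the maps $\nu_{p,q}$, $p=\dim V$, $q=\dim W$. *)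

(* Defs.v *)
From HB Require Import structures.
From mathcomp Require Import all_boot all_order all_algebra.
From mathcomp Require Import all_classical all_reals all_analysis.
From mathcomp Require Import ring lra.
From Stdlib Require Import Relation_Operators.
Set Implicit Arguments.
Unset Strict Implicit.
Unset Printing Implicit Defensive.
Import Order.TTheory GRing.Theory Num.Theory numFieldNormedType.Exports.
Local Open Scope classical_set_scope.
Local Open Scope ring_scope.
Local Open Scope quotient_scope.

Definition kopen (T : topologicalType) (A : set T) : Prop :=
  forall (K : topologicalType) (u : K -> T),
    compact [set: K] -> hausdorff_space K -> continuous u -> open (u @^-1` A).

Definition compactly_generated (T : topologicalType) : Prop :=
  forall A : set T, kopen A -> open A.

Definition weak_hausdorff (T : topologicalType) : Prop :=
  forall (K : topologicalType) (u : K -> T),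
    compact [set: K] -> hausdorff_space K -> continuous u -> closed (range u).

Definition cgwh (T : topologicalType) : Prop :=
  compactly_generated T /\ weak_hausdorff T.

(* T with the topology of its k-open sets. *)
Definition kify (T : Type) : Type := T.

Section kify.
Variable T : topologicalType.

Lemma kopenT : kopen [set: T].
Proof. by move=> K u _ _ _; rewrite preimage_setT; exact: openT. Qed.

Lemma kopenI : setI_closed (@kopen T).
Proof.
move=> A B kA kB K u cK hK cu; rewrite preimage_setI.
by apply: openI; [exact: kA | exact: kB].
Qed.

Lemma kopen_bigU (I : Type) (f : I -> set T) :
  (forall i, kopen (f i)) -> kopen (\bigcup_i f i).
Proof.
move=> kf K u cK hK cu; rewrite preimage_bigcup.
by apply: bigcup_open => i _; exact: kf.
Qed.

HB.instance Definition _ := Choice.on (kify T).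
HB.instance Definition _ :=
  @isOpenTopological.Build (kify T) (@kopen T) kopenT kopenI kopen_bigU.

Lemma kify_openE (A : set (kify T)) : open A = @kopen T A.
Proof. by []. Qed.

Lemma kify_continuousP (Z : topologicalType) (f : kify T -> Z) :
  (forall (K : topologicalType) (u : K -> T), compact [set: K] ->
     hausdorff_space K -> continuous u -> continuous (fun k => f (u k) : Z)) ->
  continuous f.
Proof.
move=> H; apply/continuousP => A oA; rewrite kify_openE => K u cK hK cu.
by have /continuousP := H K u cK hK cu; apply.
Qed.

Lemma kify_continuous_test (Z : topologicalType) (f : kify T -> Z)
    (K : topologicalType) (u : K -> T) : continuous f -> compact [set: K] ->
  hausdorff_space K -> continuous u -> continuous (fun k => f (u k) : Z).
Proof.
move=> /continuousP cf cK hK cu; apply/continuousP => A oA.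
exact: (cf A oA K u cK hK cu).
Qed.

Lemma kify_id_continuous : continuous (fun x : kify T => x : T).
Proof. by apply: kify_continuousP. Qed.

End kify.

HB.instance Definition _ (T : ptopologicalType) := Pointed.on (kify T).

(* The product in the category of compactly generated spaces is the k-ification of
   the product topology. *)
Definition kprod (A B : Type) : Type := kify (A * B)%type.
HB.instance Definition _ (A B : topologicalType) :=
  Topological.copy (kprod A B) (kify (A * B)%type).
HB.instance Definition _ (A B : ptopologicalType) :=
  Pointed.copy (kprod A B) (A * B)%type.

Section kprod_maps.

Lemma continuous_pair (K A B : topologicalType) (f : K -> A) (g : K -> B) :
  continuous f -> continuous g -> continuous (fun k => (f k, g k)).
Proof. by move=> cf cg k; apply: cvg_pair; [exact: cf | exact: cg]. Qed.

Lemma continuous_fst (A B : topologicalType) : continuous (@fst A B).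
Proof. by move=> x; exact: cvg_fst. Qed.

Lemma continuous_snd (A B : topologicalType) : continuous (@snd A B).
Proof. by move=> x; exact: cvg_snd. Qed.

Lemma continuous_cmp (A B C : topologicalType) (f : A -> B) (g : B -> C) :
  continuous f -> continuous g -> continuous (fun x => g (f x)).
Proof. by move=> cf cg x; apply: continuous_comp; [exact: cf | exact: cg]. Qed.

Lemma kprod_comp (T : topologicalType) (A B C : topologicalType)
    (f : kify T -> A) (g : kify T -> B) (h : kprod A B -> C) :
  continuous f -> continuous g -> continuous h ->
  continuous (fun x : kify T => h (f x, g x)).
Proof.
move=> cf cg ch; apply: kify_continuousP => K u cK hK cu.
apply: (@kify_continuous_test (A * B)%type C h K (fun k => (f (u k), g (u k))))
  => //.
by apply: continuous_pair; apply: kify_continuous_test.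
Qed.

Lemma kprod_fst (A B : topologicalType) :
  continuous (fun z : kprod A B => z.1 : A).
Proof.
exact: (continuous_cmp (@kify_id_continuous (A * B)%type) (@continuous_fst A B)).
Qed.

Lemma kprod_snd (A B : topologicalType) :
  continuous (fun z : kprod A B => z.2 : B).
Proof.
exact: (continuous_cmp (@kify_id_continuous (A * B)%type) (@continuous_snd A B)).
Qed.

End kprod_maps.

Section gen_equiv.
Variables (T : choiceType) (gen : T -> T -> Prop).

Definition gen_rel : rel T := fun x y => `[< clos_refl_sym_trans T gen x y >].

Lemma gen_rel_refl : reflexive gen_rel.
Proof. by move=> x; apply/asboolP; exact: rst_refl. Qed.

Lemma gen_rel_sym : symmetric gen_rel.
Proof. by move=> x y; apply/asboolP/asboolP; exact: rst_sym. Qed.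

Lemma gen_rel_trans : transitive gen_rel.
Proof.
by move=> y x z /asboolP xy /asboolP yz; apply/asboolP; exact: rst_trans xy yz.
Qed.

Definition gen_equiv := EquivRel gen_rel gen_rel_refl gen_rel_sym gen_rel_trans.

End gen_equiv.

(* T modulo the equivalence relation generated by gen. *)
Definition qspace (T : topologicalType) (gen : T -> T -> Prop) : Type :=
  quotient_topology {eq_quot gen_equiv gen}.

HB.instance Definition _ (T : topologicalType) (gen : T -> T -> Prop) :=
  Topological.on (qspace gen).
HB.instance Definition _ (T : topologicalType) (gen : T -> T -> Prop) :=
  Quotient.on (qspace gen).

Definition qpi (T : topologicalType) (gen : T -> T -> Prop) (x : T) : qspace gen :=
  \pi_(qspace gen) x.

HB.instance Definition _ (T : ptopologicalType) (gen : T -> T -> Prop) :=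
  isPointed.Build (qspace gen) (qpi gen point).

Definition qlift (T : topologicalType) (gen : T -> T -> Prop) (Z : Type)
  (f : T -> Z) (q : qspace gen) : Z := f (repr q).

Section qspace.
Variables (T : topologicalType) (gen : T -> T -> Prop).

Lemma qpi_eq x y : gen x y -> qpi gen x = qpi gen y.
Proof. by move=> gxy; apply/eqmodP/asboolP; exact: rst_step. Qed.

Lemma qpiP (q : qspace gen) : exists x, q = qpi gen x.
Proof. by exists (repr q); rewrite /qpi reprK. Qed.

Lemma qliftE (Z : Type) (f : T -> Z) x :
  (forall x y, gen x y -> f x = f y) -> qlift f (qpi gen x) = f x.
Proof.
move=> fg; rewrite /qlift.
have /eqmodP/asboolP : repr (qpi gen x) = x %[mod {eq_quot gen_equiv gen}].
  exact: (@reprK _ (qspace gen)).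
by move: (repr _) => y; elim=> [a b /fg|//|a b _ ->|a b c _ -> _ ->].
Qed.

Lemma qpi_continuous : continuous (qpi gen).
Proof. exact: (@pi_continuous T {eq_quot gen_equiv gen}). Qed.

Lemma qspace_continuous (Z : topologicalType) (f : qspace gen -> Z) :
  continuous (fun x => f (qpi gen x)) -> continuous f.
Proof. by move=> cf; apply/(@quotient_continuous T {eq_quot gen_equiv gen}). Qed.

Lemma qlift_continuous (Z : topologicalType) (f : T -> Z) :
  (forall x y, gen x y -> f x = f y) -> continuous f ->
  continuous (qlift f : qspace gen -> Z).
Proof.
move=> fg cf; apply: qspace_continuous.
by rewrite (_ : (fun x => _) = f)//; apply/funext => x; rewrite qliftE.
Qed.

End qspace.

Record based_map (A B : ptopologicalType) := BasedMap {
  bmap_fun :> A -> B;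
  bmap_continuous : continuous bmap_fun;
  bmap_point : bmap_fun point = point }.

Definition smash_wedge (A B : ptopologicalType) (x : kprod A B) : Prop :=
  x.1 = point \/ x.2 = point.

Definition smash_gen (A B : ptopologicalType) (x y : kprod A B) : Prop :=
  smash_wedge x /\ smash_wedge y.

(* Points of weak Hausdorff spaces are closed, so for cgwh A and B the collapsed
   subspace is closed and this quotient is again cgwh. *)
Definition smash (A B : ptopologicalType) : Type := qspace (@smash_gen A B).
HB.instance Definition _ (A B : ptopologicalType) :=
  PointedTopological.on (smash A B).

Definition smk (A B : ptopologicalType) (a : A) (b : B) : smash A B :=
  qpi (@smash_gen A B) (a, b).
Arguments smk {A B} & a b.

Definition smash_lift (A B : ptopologicalType) (Z : Type) (f : A -> B -> Z) :
  smash A B -> Z := qlift (fun x : kprod A B => f x.1 x.2).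

Section smash.
Variables A B : ptopologicalType.

Lemma smk_ptl (b : B) : smk (point : A) b = point.
Proof. by apply: qpi_eq; split; left. Qed.

Lemma smk_ptr (a : A) : smk a (point : B) = point.
Proof. by apply: qpi_eq; split; [right|left]. Qed.

Lemma smkP (s : smash A B) : exists a b, s = smk a b.
Proof. by have [[a b] ->] := qpiP s; exists a, b. Qed.

Lemma smash_liftE (Z : ptopologicalType) (f : A -> B -> Z) a b :
  (forall b, f point b = point) -> (forall a, f a point = point) ->
  smash_lift f (smk a b) = f a b.
Proof.
move=> fl fr; rewrite /smash_lift /smk qliftE//.
have H z : smash_wedge z -> f z.1 z.2 = point by case=> ->.
by move=> x y [/H -> /H ->].
Qed.

Lemma smash_continuous (Z : topologicalType) (f : smash A B -> Z) :
  continuous (fun z : kprod A B => f (smk z.1 z.2)) -> continuous f.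
Proof.
move=> cf; apply: qspace_continuous.
by rewrite (_ : (fun x => _) = (fun z : kprod A B => f (smk z.1 z.2)))//;
  apply/funext => -[].
Qed.

Lemma smk_continuous : continuous (fun z : kprod A B => smk z.1 z.2).
Proof.
rewrite (_ : (fun z => _) = qpi (@smash_gen A B)); first exact: qpi_continuous.
by apply/funext => -[].
Qed.

End smash.

Lemma bmap_smk_ptl (A B C : ptopologicalType) (f : based_map (smash A B) C) b :
  f (smk (point : A) b) = point.
Proof. by rewrite smk_ptl bmap_point. Qed.

Lemma bmap_smk_ptr (A B C : ptopologicalType) (f : based_map (smash A B) C) a :
  f (smk a (point : B)) = point.
Proof. by rewrite smk_ptr bmap_point. Qed.

(* T_+, with the disjoint base point None. *)
Definition addpt (T : Type) : Type := option T.

Section addpt.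
Variable T : topologicalType.

Definition addpt_open (A : set (addpt T)) : Prop := open (Some @^-1` A : set T).

Lemma addpt_openT : addpt_open setT.
Proof. exact: openT. Qed.

Lemma addpt_openI : setI_closed addpt_open.
Proof. by move=> A B; exact: openI. Qed.

Lemma addpt_open_bigU (I : Type) (f : I -> set (addpt T)) :
  (forall i, addpt_open (f i)) -> addpt_open (\bigcup_i f i).
Proof.
by move=> H; rewrite /addpt_open preimage_bigcup; apply: bigcup_open => i _; exact: H.
Qed.

HB.instance Definition _ := Choice.on (addpt T).
HB.instance Definition _ :=
  @isOpenTopological.Build (addpt T) addpt_open addpt_openT addpt_openI addpt_open_bigU.
HB.instance Definition _ := isPointed.Build (addpt T) None.

Lemma addpt_continuous (Z : topologicalType) (f : addpt T -> Z) :
  continuous (fun t => f (Some t)) -> continuous f.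
Proof. by move=> /continuousP cf; apply/continuousP => A oA; exact: cf. Qed.

Lemma addpt_Some_continuous : continuous (Some : T -> addpt T).
Proof. exact/continuousP. Qed.

End addpt.

Record ips (R : realType) := Ips {
  ips_sort :> vectType R;
  dot : {dot ips_sort for idfun} }.

Section dot_theory.
Variables (R : realType) (V : ips R).
Implicit Types u v w : V.

Lemma dotC u v : dot V u v = dot V v u.
Proof. by rewrite hermC expr0 mul1r. Qed.
Lemma dotDl u v w : dot V (u + v) w = dot V u w + dot V v w.
Proof. by rewrite linearDl. Qed.
Lemma dotZl a u w : dot V (a *: u) w = a * dot V u w.
Proof. by rewrite linearZl. Qed.
Lemma dotDr u v w : dot V w (u + v) = dot V w u + dot V w v.
Proof. by rewrite !(dotC w) dotDl. Qed.
Lemma dotZr a u w : dot V w (a *: u) = a * dot V w u.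
Proof. by rewrite !(dotC w) dotZl. Qed.
Lemma dot0l w : dot V 0 w = 0.
Proof. by rewrite -(scale0r 0) dotZl mul0r. Qed.
Lemma dotNl u w : dot V (- u) w = - dot V u w.
Proof. by rewrite -scaleN1r dotZl mulN1r. Qed.
Lemma dotNr u w : dot V w (- u) = - dot V w u.
Proof. by rewrite !(dotC w) dotNl. Qed.
Lemma dot_gt0 u : u != 0 -> 0 < dot V u u.
Proof. exact: neq0_dnorm_gt0. Qed.
Lemma dot_ge0 u : 0 <= dot V u u.
Proof. by have [->|/dot_gt0/ltW//] := eqVneq u 0; rewrite dot0l. Qed.
Lemma dot_eq0 u : dot V u u = 0 -> u = 0.
Proof.
by move=> d0; apply/eqP/negPn/negP => /dot_gt0; rewrite d0 ltxx.
Qed.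

Definition enorm u : R := Num.sqrt (dot V u u).

Lemma enorm_ge0 u : 0 <= enorm u. Proof. exact: sqrtr_ge0. Qed.
Lemma sqr_enorm u : enorm u ^+ 2 = dot V u u.
Proof. by rewrite sqr_sqrtr// dot_ge0. Qed.

Lemma dot_CS u v : dot V u v ^+ 2 <= dot V u u * dot V v v.
Proof.
have [->|v0] := eqVneq v 0; first by rewrite dotC !dot0l expr0n mulr0.
have dv := dot_gt0 v0.
have := dot_ge0 (dot V v v *: u - dot V u v *: v).
rewrite dotDl !dotDr !dotNl !dotNr !dotZl !dotZr (dotC v u).
set a := dot V u u; set b := dot V u v; set c := dot V v v => H.
have : 0 <= c * (c * a - b ^+ 2).
  by apply: le_trans H _; rewrite expr2 le_eqVlt; apply/orP; left; apply/eqP; ring.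
by rewrite pmulr_rge0// subr_ge0 mulrC.
Qed.

Lemma enormD u v : enorm (u + v) <= enorm u + enorm v.
Proof.
rewrite -(@ler_pXn2r _ 2)// ?nnegrE ?addr_ge0 ?enorm_ge0// sqrrD !sqr_enorm.
rewrite dotDl !dotDr (dotC v u).
have H : dot V u v <= enorm u * enorm v.
  have [d0|d0] := leP (dot V u v) 0.
    by apply: le_trans d0 _; rewrite mulr_ge0 ?enorm_ge0.
  rewrite -(@ler_pXn2r _ 2)// ?nnegrE ?mulr_ge0 ?enorm_ge0 ?(ltW d0)//.
  by rewrite exprMn !sqr_enorm dot_CS.
by lra.
Qed.

Lemma enormZ (a : R) u : enorm (a *: u) = `|a| * enorm u.
Proof.
by rewrite /enorm dotZl dotZr mulrA -expr2 sqrtrM ?sqr_ge0// sqrtr_sqr.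
Qed.

Lemma enorm0_eq0 u : enorm u = 0 -> u = 0.
Proof. by move=> n0; apply: dot_eq0; rewrite -sqr_enorm n0 expr0n. Qed.

End dot_theory.

(* V with the norm, hence the topology, given by its inner product; the default
   norm of 'rV[R]_n and of product spaces is the sup norm. *)
Definition espace (R : realType) (V : ips R) : Type := V.

HB.instance Definition _ (R : realType) (V : ips R) := GRing.Lmodule.on (espace V).
HB.instance Definition _ (R : realType) (V : ips R) :=
  @Lmodule_isNormed.Build R (espace V) (@enorm R V)
    (@enormD R V) (@enormZ R V) (@enorm0_eq0 R V).

Definition rvdot (R : realType) n (x y : 'rV[R]_n) : R :=
  \sum_i x ord0 i * y ord0 i.

Section rvdot.
Variables (R : realType) (n : nat).

Lemma rvdot_bilinear :
  bilinear_for *%R (idfun \; *%R) (@rvdot R n).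
Proof.
split=> [w a u v|w a u v]; rewrite /rvdot /= mulr_sumr -big_split/=;
  by apply: eq_bigr => i _; rewrite !mxE; ring.
Qed.

HB.instance Definition _ := @bilinear_isBilinear.Build R 'rV[R]_n 'rV[R]_n R
  (GRing.Scale.Law.clone _ _ *%R _) (GRing.Scale.Law.clone _ _ (idfun \; *%R) _)
  (@rvdot R n) rvdot_bilinear.

Lemma rvdot_herm (x y : 'rV[R]_n) : rvdot x y = (-1) ^+ false * idfun (rvdot y x).
Proof. by rewrite expr0 mul1r; apply: eq_bigr => i _; rewrite mulrC. Qed.

HB.instance Definition _ := isHermitianSesquilinear.Build R 'rV[R]_n false idfun
  (@rvdot R n) rvdot_herm.

Lemma rvdot_gt0 (x : 'rV[R]_n) : x != 0 -> 0 < rvdot x x.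
Proof.
move=> x0; rewrite lt_neqAle sumr_ge0 ?andbT; last by move=> i _; exact: sqr_ge0.
apply: contra x0 => /eqP/esym/psumr_eq0P H; apply/eqP/rowP => i; rewrite mxE.
by have /eqP := H (fun i _ => sqr_ge0 _) i isT; rewrite mulf_eq0 orbb => /eqP.
Qed.

HB.instance Definition _ := isDotProduct.Build R 'rV[R]_n (@rvdot R n) rvdot_gt0.

Definition euclid : ips R := Ips (@rvdot R n : {dot 'rV[R]_n for idfun}).

End rvdot.

Definition pairdot (R : realType) (V W : ips R) (x y : V * W) : R :=
  dot V x.1 y.1 + dot W x.2 y.2.

Section pairdot.
Variables (R : realType) (V W : ips R).

Lemma pairdot_bilinear : bilinear_for *%R (idfun \; *%R) (@pairdot R V W).
Proof.
split=> [w a u v|w a u v]; rewrite /pairdot/=.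
  by rewrite !dotDl !dotZl; ring.
by rewrite !dotDr !dotZr; ring.
Qed.

HB.instance Definition _ := @bilinear_isBilinear.Build R (V * W)%type (V * W)%type R
  (GRing.Scale.Law.clone _ _ *%R _) (GRing.Scale.Law.clone _ _ (idfun \; *%R) _)
  (@pairdot R V W) pairdot_bilinear.

Lemma pairdot_herm x y :
  pairdot x y = (-1) ^+ false * idfun (@pairdot R V W y x).
Proof. by rewrite expr0 mul1r /= /pairdot (dotC x.1) (dotC x.2). Qed.

HB.instance Definition _ := isHermitianSesquilinear.Build R (V * W)%type false idfun
  (@pairdot R V W) pairdot_herm.

Lemma pairdot_gt0 (x : V * W) : x != 0 -> 0 < pairdot x x.
Proof.
case: x => v w; rewrite /pairdot/=.
have [->|v0 _] := eqVneq v 0; last by rewrite ltr_wpDr ?dot_ge0 ?dot_gt0.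
have [->|w0 _] := eqVneq w 0; first by rewrite eqxx.
by rewrite ltr_wpDl ?dot_ge0 ?dot_gt0.
Qed.

HB.instance Definition _ :=
  isDotProduct.Build R (V * W)%type (@pairdot R V W) pairdot_gt0.

Definition dsum : ips R := Ips (@pairdot R V W : {dot (V * W)%type for idfun}).

End pairdot.

Record isom (R : realType) (V W : ips R) := Isom {
  isom_fun :> V -> W;
  isom_linear : linear isom_fun;
  isom_dot : forall u v, dot W (isom_fun u) (isom_fun v) = dot V u v;
  isom_bij : bijective isom_fun }.

Section isom_alg.
Variable R : realType.
Implicit Types V W X : ips R.

Lemma isom_eq V W (f g : isom V W) : f =1 g -> f = g.
Proof.
case: f g => [f lf df bf] [g lg dg bg]/= /funext fg; subst g.
by congr Isom; exact: Prop_irrelevance.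
Qed.

Lemma isomD V W (f : isom V W) u v : f (u + v) = f u + f v.
Proof. by have := isom_linear f 1 u v; rewrite !scale1r. Qed.

Lemma isom0 V W (f : isom V W) : f 0 = 0.
Proof. by apply: (@addrI _ (f 0)); rewrite -isomD !addr0. Qed.

Lemma isomZ V W (f : isom V W) a u : f (a *: u) = a *: f u.
Proof. by have := isom_linear f a u 0; rewrite isom0 !addr0. Qed.

Lemma isomB V W (f : isom V W) u v : f (u - v) = f u - f v.
Proof. by rewrite isomD -scaleN1r isomZ scaleN1r. Qed.

Lemma isom_norm V W (f : isom V W) u : enorm (f u) = enorm u.
Proof. by rewrite /enorm isom_dot. Qed.

Definition isom_id V : isom V V :=
  @Isom R V V id (fun a u v => erefl) (fun u v => erefl)
    (Bijective (fun=> erefl) (fun=> erefl)).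

Lemma isom_comp_linear V W X (g : isom W X) (f : isom V W) :
  linear (fun v => g (f v)).
Proof. by move=> a u v; rewrite !isom_linear. Qed.

Lemma isom_comp_dot V W X (g : isom W X) (f : isom V W) u v :
  dot X (g (f u)) (g (f v)) = dot V u v.
Proof. by rewrite !isom_dot. Qed.

Definition isom_comp V W X (g : isom W X) (f : isom V W) : isom V X :=
  Isom (isom_comp_linear g f) (isom_comp_dot g f)
    (bij_comp (isom_bij g) (isom_bij f)).

Lemma isom_ex_inv V W (f : isom V W) : exists g, cancel f g /\ cancel g f.
Proof. by have [g fK gK] := isom_bij f; exists g. Qed.

Definition isom_inv_fun V W (f : isom V W) : W -> V := projT1 (cid (isom_ex_inv f)).

Lemma isomK V W (f : isom V W) : cancel f (isom_inv_fun f).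
Proof. by rewrite /isom_inv_fun; case: cid => ? []. Qed.

Lemma isomKV V W (f : isom V W) : cancel (isom_inv_fun f) f.
Proof. by rewrite /isom_inv_fun; case: cid => ? []. Qed.

Lemma isom_inv_linear V W (f : isom V W) : linear (isom_inv_fun f).
Proof.
by move=> a u v; apply: (can_inj (isomK f)); rewrite isom_linear !isomKV.
Qed.

Lemma isom_inv_dot V W (f : isom V W) u v :
  dot V (isom_inv_fun f u) (isom_inv_fun f v) = dot W u v.
Proof. by rewrite -(isom_dot f) !isomKV. Qed.

Definition isom_inv V W (f : isom V W) : isom W V :=
  Isom (isom_inv_linear f) (isom_inv_dot f) (Bijective (isomKV f) (isomK f)).

Lemma isom_invK V W (f : isom V W) v : isom_inv f (f v) = v.
Proof. exact: isomK. Qed.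
Lemma isom_invKV V W (f : isom V W) v : f (isom_inv f v) = v.
Proof. exact: isomKV. Qed.

End isom_alg.

HB.instance Definition _ (R : realType) (V W : ips R) := gen_eqMixin (isom V W).
HB.instance Definition _ (R : realType) (V W : ips R) := gen_choiceMixin (isom V W).

(* As V is finite dimensional, the topology of pointwise convergence is the
   topology of O(V,W) as a subspace of the vector space Hom(V,W). *)
HB.instance Definition _ (R : realType) (V W : ips R) :=
  Topological.copy (isom V W)
    (initial_topology
       (fun f : isom V W => (f : espace V -> espace W) : {ptws espace V -> espace W})).

Section isom_top.
Variable R : realType.
Implicit Types V W X : ips R.

Definition isom_ptws V W (f : isom V W) : {ptws espace V -> espace W} :=
  f : espace V -> espace W.

Lemma isom_eval_continuous V W (v : V) :
  continuous (fun f : isom V W => f v : espace W).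
Proof.
apply: (@continuous_cmp _ _ _ (@isom_ptws V W)
  (@proj (espace V) (fun=> espace W) v)); last exact: proj_continuous.
exact: (@initial_continuous _ _ (@isom_ptws V W)).
Qed.

Lemma isom_continuousP V W (T : topologicalType) (h : T -> isom V W) :
  (forall v, continuous (fun t => h t v : espace W)) -> continuous h.
Proof.
move=> ch; apply: (@continuous_comp_initial _ _ _ (@isom_ptws V W)) => t.
apply/pointwise_cvgP => v; exact: ch.
Qed.

Lemma near_norm V (v : espace V) (e : R) :
  0 < e -> \forall u \near v, `|v - u| < e.
Proof.
move=> e0; have : nbhs v (ball v e) by exact: nbhsx_ballx.
by rewrite -ball_normE.
Qed.

Lemma enorm_continuousP (T : topologicalType) V (h : T -> espace V) :
  continuous h <->
  forall t e, 0 < e -> nbhs t [set s | enorm ((h t : V) - h s) < e].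
Proof.
split=> [ch t e e0|ch t].
  by have /(@cvgrPdist_lt _ (espace V)) := ch t; exact.
by apply/(@cvgrPdist_lt _ (espace V)) => e e0; exact: ch.
Qed.

Lemma isom_fun_continuous V W (f : isom V W) :
  continuous (f : espace V -> espace W).
Proof.
apply/enorm_continuousP => v e e0; apply: filterS (near_norm v e0) => u /=.
by rewrite -isomB isom_norm.
Qed.

Lemma isom_app_continuous V W :
  continuous (fun z : isom V W * espace V => z.1 z.2 : espace W).
Proof.
apply/enorm_continuousP => -[f v] e e0 /=.
have e20 : 0 < e / 2 by rewrite divr_gt0.
have /enorm_continuousP/(_ (f, v : espace V) _ e20) cf : 
    continuous (fun z : isom V W * espace V => z.1 v : espace W).
  exact: (continuous_cmp (@continuous_fst _ _) (@isom_eval_continuous V W v)).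
have /enorm_continuousP/(_ (f, v : espace V) _ e20) cv : 
    continuous (fun z : isom V W * espace V => z.2 : espace V).
  exact: continuous_snd.
apply: filterS2 cf cv => -[g u]/= zf zv.
have -> : f v - g u = (f v - g v) + (g v - g u) by rewrite addrA subrK.
rewrite (splitr e); apply: le_lt_trans (enormD _ _) _; apply: ltrD => //.
by rewrite -isomB isom_norm.
Qed.

Lemma isom_comp_continuous V W X :
  continuous (fun z : isom W X * isom V W => isom_comp z.1 z.2).
Proof.
apply: isom_continuousP => v.
have c1 : continuous
    (fun z : isom W X * isom V W => (z.1, z.2 v) : isom W X * espace W).
  apply: continuous_pair; first exact: continuous_fst.
  exact: (continuous_cmp (@continuous_snd _ _) (@isom_eval_continuous V W v)).
exact: (continuous_cmp c1 (@isom_app_continuous W X)).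
Qed.

Lemma isom_inv_continuous V W : continuous (@isom_inv R V W).
Proof.
apply: isom_continuousP => w; apply/enorm_continuousP => f e e0.
have /enorm_continuousP/(_ f _ e0) := @isom_eval_continuous V W (isom_inv f w).
apply: filterS => g /=; rewrite -/(isom_inv f w) [f _]isom_invKV => H.
rewrite -(isom_norm g) isomB [g (isom_inv_fun g w)]isom_invKV.
by rewrite -opprB -scaleN1r enormZ normrN1 mul1r.
Qed.

End isom_top.

HB.mixin Record isTopGroup G & Group G & Topological G := {
  mulg_continuous : continuous (fun x : G * G => (x.1 * x.2)%g : G);
  invg_continuous : continuous (fun x : G => (x^-1)%g : G) }.

#[short(type="topGroupType")]
HB.structure Definition TopGroup :=
  {G of Group G & Topological G & isTopGroup G}.

Section pair_topGroup.
Variables G H : topGroupType.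

Lemma pair_mulg_continuous :
  continuous (fun x : (G * H) * (G * H) => (x.1 * x.2)%g : G * H).
Proof.
pose p1 := fun x : (G * H) * (G * H) => (x.1.1, x.2.1).
pose p2 := fun x : (G * H) * (G * H) => (x.1.2, x.2.2).
have c1 : continuous p1.
  by apply: continuous_pair; apply: continuous_cmp;
    try exact: continuous_fst; exact: continuous_snd.
have c2 : continuous p2.
  by apply: continuous_pair; apply: continuous_cmp;
    try exact: continuous_snd; exact: continuous_fst.
apply: continuous_pair.
  exact: (continuous_cmp c1 (@mulg_continuous G)).
exact: (continuous_cmp c2 (@mulg_continuous H)).
Qed.

Lemma pair_invg_continuous : continuous (fun x : G * H => (x^-1)%g : G * H).
Proof.
apply: continuous_pair.
  exact: (continuous_cmp (@continuous_fst G H) (@invg_continuous G)).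
exact: (continuous_cmp (@continuous_snd G H) (@invg_continuous H)).
Qed.

HB.instance Definition _ := isTopGroup.Build (G * H)%type
  pair_mulg_continuous pair_invg_continuous.

End pair_topGroup.

Section isom_group.
Variables (R : realType) (V : ips R).

Lemma isom_mulA : associative (@isom_comp R V V V).
Proof. by move=> f g h; exact: isom_eq. Qed.
Lemma isom_mul1 : left_id (isom_id V) (@isom_comp R V V V).
Proof. by move=> f; exact: isom_eq. Qed.
Lemma isom_mulr1 : right_id (isom_id V) (@isom_comp R V V V).
Proof. by move=> f; exact: isom_eq. Qed.
Lemma isom_mulV : left_inverse (isom_id V) (@isom_inv R V V) (@isom_comp R V V V).
Proof. by move=> f; apply: isom_eq => v; exact: isom_invK. Qed.
Lemma isom_mulrV : right_inverse (isom_id V) (@isom_inv R V V) (@isom_comp R V V V).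
Proof. by move=> f; apply: isom_eq => v; exact: isom_invKV. Qed.

HB.instance Definition _ := isMonoid.Build (isom V V) isom_mulA isom_mul1 isom_mulr1.
HB.instance Definition _ := hasInv.Build (isom V V) (@isom_inv R V V).
HB.instance Definition _ := Monoid_isGroup.Build (isom V V) isom_mulV isom_mulrV.
HB.instance Definition _ := isTopGroup.Build (isom V V)
  (@isom_comp_continuous R V V V) (@isom_inv_continuous R V V).

End isom_group.

Section frame.
Variable R : realType.
Implicit Types V W : ips R.

Lemma dot_suml V (I : Type) (r : seq I) (F : I -> V) w :
  dot V (\sum_(i <- r) F i) w = \sum_(i <- r) dot V (F i) w.
Proof.
exact: (big_morph (fun u => dot V u w) (fun a b => dotDl a b w) (dot0l w)).
Qed.

Lemma orthonormal_family V k : (k <= dim V)%N ->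
  exists b : nat -> V, forall i j, (i < k)%N -> (j < k)%N ->
    dot V (b i) (b j) = (i == j)%:R.
Proof.
elim: k => [_|k IHk kV]; first by exists (fun=> 0).
have [b ob] := IHk (ltnW kV).
have [v vb] : exists v : V, v \notin <<[seq b i | i <- iota 0 k]>>%VS.
  apply: contrapT => /forallNP H.
  have : (fullv <= <<[seq b i | i <- iota 0 k]>>)%VS.
    by apply/subvP => v _; apply/negPn/negP/H.
  move=> /dimvS; rewrite dimvf leqNgt => /negP; apply.
  by apply: leq_ltn_trans (dim_span _) _; rewrite size_map size_iota.
pose w := v - \sum_(i < k) dot V v (b i) *: b i.
have w0 : w != 0.
  rewrite subr_eq0; apply: contra vb => /eqP ->.
  apply: memv_suml => i _; apply: memvZ; apply: memv_span.
  by apply/mapP; exists (i : nat); rewrite ?mem_iota ?add0n ?ltn_ord.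
have wb j : (j < k)%N -> dot V w (b j) = 0.
  move=> jk; rewrite /w dotDl dotNl.
  rewrite dot_suml (bigD1 (Ordinal jk))//= dotZl ob// eqxx mulr1.
  rewrite big1 ?addr0 ?subrr// => i ij.
  rewrite dotZl ob//; case: eqP => [e|]; last by rewrite mulr0.
  by move: ij; rewrite -val_eqE /= e eqxx.
have nw : enorm w != 0.
  by apply: contra w0 => /eqP/enorm0_eq0 ->.
pose u := (enorm w)^-1 *: w.
have ub j : (j < k)%N -> dot V u (b j) = 0.
  by move=> jk; rewrite dotZl wb ?mulr0.
have uu : dot V u u = 1.
  by rewrite dotZl dotZr -sqr_enorm; field.
exists (fun i => if (i < k)%N then b i else u) => i j.
rewrite !ltnS => ik jk.
case: ltnP => ik'; case: ltnP => jk'.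
- exact: ob.
- by rewrite dotC ub// [in RHS]ltn_eqF// (leq_trans ik').
- by rewrite ub// eq_sym [in RHS]ltn_eqF// (leq_trans jk').
- rewrite uu (_ : i = j) ?eqxx//; apply/eqP.
  by rewrite eqn_leq (leq_trans ik) // (leq_trans jk).
Qed.

Lemma isom_dim_le V W (f : isom V W) : (dim V <= dim W)%N.
Proof.
pose g := GRing.isLinear.Build R V W *:%R f (isom_linear f).
pose h : {linear V -> W} := HB.pack (isom_fun f) g.
have k0 : (fullv :&: lker (linfun h) = 0)%VS.
  apply/eqP; rewrite -subv0; apply/subvP => x; rewrite memv_cap memv_ker => /andP[_].
  by rewrite lfunE /= memv0 -(isom0 f) (bij_eq (isom_bij f)).
by rewrite -(dimvf V) -(limg_dim_eq k0) -(dimvf W) dimvS ?subvf.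
Qed.

Lemma isom_dim V W (f : isom V W) : dim V = dim W.
Proof.
by apply/eqP; rewrite eqn_leq (isom_dim_le f) (isom_dim_le (isom_inv f)).
Qed.

Lemma euclid_dim n : dim (euclid R n) = n.
Proof. exact: etrans (dim_matrix _ _ _) (mul1n n). Qed.

Lemma frame_ex V : exists f : isom (euclid R (dim V)) V, True.
Proof.
have [b ob] := orthonormal_family (leqnn (dim V)).
pose F (x : euclid R (dim V)) : V := \sum_i x ord0 i *: b i.
have linF : linear F.
  move=> a x y; rewrite /F scaler_sumr -big_split/=; apply: eq_bigr => i _.
  by rewrite !mxE scalerDl scalerA.
have dotFb x j : dot V (F x) (b (j : 'I_(dim V))) = x ord0 j.
  rewrite /F dot_suml (bigD1 j)//= dotZl ob// eqxx mulr1 big1 ?addr0// => i ij.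
  by rewrite dotZl ob// val_eqE (negbTE ij) mulr0.
have dotF x y : dot V (F x) (F y) = dot (euclid R (dim V)) x y.
  rewrite dotC {1}/F dot_suml; apply: eq_bigr => i _.
  by rewrite dotZl dotC dotFb mulrC.
have injF : injective F.
  by move=> x y Fxy; apply/rowP => i; rewrite -!dotFb Fxy.
pose g := GRing.isLinear.Build R (euclid R (dim V)) V *:%R F linF.
pose h : {linear euclid R (dim V) -> V} := HB.pack F g.
have k0 : (fullv :&: lker (linfun h) = 0)%VS.
  apply/eqP; rewrite -subv0; apply/subvP => x; rewrite memv_cap memv_ker => /andP[_].
  rewrite lfunE /= memv0 => /eqP Fx0; apply/eqP/injF; rewrite Fx0.
  by rewrite /F big1// => i _; rewrite mxE scale0r.
have sF v : exists x, F x = v.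
  have : v \in limg (linfun h).
    suff -> : limg (linfun h) = fullv by exact: memvf.
    apply/eqP; rewrite eqEdim subvf /= (limg_dim_eq k0) !dimvf.
    by rewrite (euclid_dim (dim V)).
  by move=> /memv_imgP[x _ ->]; exists x; rewrite lfunE.
have bijF : bijective F.
  pose G v := projT1 (cid (sF v)).
  have FG v : F (G v) = v by rewrite /G; case: cid.
  by exists G => // x; apply: injF; rewrite FG.
by exists (Isom linF dotF bijF).
Qed.

Definition frame V : isom (euclid R (dim V)) V := projT1 (cid (frame_ex V)).

End frame.

(* f : R^m -> R^n is smooth on the open set D when all its iterated directional
   derivatives exist and are continuous on D. *)
Fixpoint Ck (R : realType) (k m n : nat) (D : set 'rV[R]_m)
    (f : 'rV[R]_m -> 'rV[R]_n) : Prop :=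
  (forall x, D x -> {for x, continuous f}) /\
  if k is k'.+1 then
    forall v : 'rV[R]_m, (forall x, D x -> derivable f x v) /\ Ck k' D ('D_v f)
  else True.

Definition smooth (R : realType) (m n : nat) (D : set 'rV[R]_m)
  (f : 'rV[R]_m -> 'rV[R]_n) : Prop := forall k, Ck k D f.

Record chart (R : realType) (M : topologicalType) (n : nat) := Chart {
  chart_dom : set M;
  chart_fun : M -> 'rV[R]_n;
  chart_inv : 'rV[R]_n -> M;
  chart_open_dom : open chart_dom;
  chart_open_img : open (chart_fun @` chart_dom);
  chart_funK : forall x, chart_dom x -> chart_inv (chart_fun x) = x;
  chart_fun_continuous : forall x, chart_dom x -> {for x, continuous chart_fun};
  chart_inv_continuous : forall y, (chart_fun @` chart_dom) y ->
    {for y, continuous chart_inv} }.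

Definition chart_img (R : realType) (M : topologicalType) (n : nat)
  (c : chart R M n) : set 'rV[R]_n := chart_fun c @` chart_dom c.

Definition smooth_atlas (R : realType) (M : topologicalType) (n : nat)
    (A : set (chart R M n)) : Prop :=
  (forall x, exists2 c, A c & chart_dom c x) /\
  (forall c d, A c -> A d ->
     smooth (chart_img c `&` chart_inv c @^-1` chart_dom d)
            (chart_fun d \o chart_inv c)).

Definition smooth_mul (R : realType) (G : topGroupType) (n : nat)
    (A : set (chart R G n)) : Prop :=
  forall c d e, A c -> A d -> A e ->
    let mul (z : 'rV[R]_(n + n)) : G :=
      (chart_inv c (lsubmx z) * chart_inv d (rsubmx z))%g in
    smooth [set z | [/\ chart_img c (lsubmx z), chart_img d (rsubmx z) &
                        chart_dom e (mul z)]]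
           (chart_fun e \o mul).

Definition smooth_inv (R : realType) (G : topGroupType) (n : nat)
    (A : set (chart R G n)) : Prop :=
  forall c e, A c -> A e ->
    let inv (z : 'rV[R]_n) : G := ((chart_inv c z)^-1)%g in
    smooth (chart_img c `&` inv @^-1` chart_dom e) (chart_fun e \o inv).

(* Second countability is implied by compactness. *)
Definition compact_lie_group (R : realType) (G : topGroupType) : Prop :=
  [/\ compact [set: G], hausdorff_space G &
      exists n (A : set (chart R G n)),
        [/\ smooth_atlas A, smooth_mul A & smooth_inv A]].

Section dsum_isom.
Variable R : realType.
Implicit Types U V W : ips R.

Section dsum_map.
Variables (V V' W W' : ips R) (f : isom V V') (g : isom W W').

Definition isom_dsum_fun (x : dsum V W) : dsum V' W' := (f x.1, g x.2).

Lemma isom_dsum_linear : linear isom_dsum_fun.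
Proof. by move=> a u v; rewrite /isom_dsum_fun !isom_linear. Qed.

Lemma isom_dsum_dot u v :
  dot (dsum V' W') (isom_dsum_fun u) (isom_dsum_fun v) = dot (dsum V W) u v.
Proof. by rewrite /= /pairdot !isom_dot. Qed.

Lemma isom_dsum_bij : bijective isom_dsum_fun.
Proof.
exists (fun x => (isom_inv f x.1, isom_inv g x.2)) => -[v w];
  by rewrite /isom_dsum_fun/= ?isomK ?isomKV.
Qed.

Definition isom_dsum : isom (dsum V W) (dsum V' W') :=
  Isom isom_dsum_linear isom_dsum_dot isom_dsum_bij.

End dsum_map.

Section dsum_assoc.
Variables U V W : ips R.

Definition isom_assoc_fun (x : dsum (dsum U V) W) : dsum U (dsum V W) :=
  (x.1.1, (x.1.2, x.2)).

Lemma isom_assoc_dot u v :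
  dot (dsum U (dsum V W)) (isom_assoc_fun u) (isom_assoc_fun v) =
  dot (dsum (dsum U V) W) u v.
Proof. by rewrite /= /pairdot /= /pairdot addrA. Qed.

Lemma isom_assoc_bij : bijective isom_assoc_fun.
Proof. by exists (fun x => ((x.1, x.2.1), x.2.2)); [move=> [[] ]|move=> [? []]]. Qed.

Definition isom_assoc : isom (dsum (dsum U V) W) (dsum U (dsum V W)) :=
  Isom (fun a u v => erefl) isom_assoc_dot isom_assoc_bij.

End dsum_assoc.

Section dsum_unit.
Variable W : ips R.

Definition isom_unitl_fun (x : dsum (euclid R 0) W) : W := x.2.

Lemma isom_unitl_dot u v :
  dot W (isom_unitl_fun u) (isom_unitl_fun v) = dot (dsum (euclid R 0) W) u v.
Proof. by rewrite /= /pairdot /= /rvdot big_ord0 add0r. Qed.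

Lemma isom_unitl_bij : bijective isom_unitl_fun.
Proof. by exists (fun w => (0, w)) => // -[x w]; rewrite (thinmx0 x). Qed.

Definition isom_unitl : isom (dsum (euclid R 0) W) W :=
  Isom (fun a u v => erefl) isom_unitl_dot isom_unitl_bij.

End dsum_unit.

Section dsum_row.
Variables p q : nat.

Definition isom_row_fun (x : dsum (euclid R p) (euclid R q)) : euclid R (p + q) :=
  row_mx x.1 x.2.

Lemma isom_row_linear : linear isom_row_fun.
Proof.
by move=> a [u u'] [v v']; rewrite /isom_row_fun/= scale_row_mx add_row_mx.
Qed.

Lemma isom_row_dot u v :
  dot (euclid R (p + q)) (isom_row_fun u) (isom_row_fun v) =
  dot (dsum (euclid R p) (euclid R q)) u v.
Proof.
rewrite /= /pairdot /= /rvdot big_split_ord/=.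
by congr (_ + _); apply: eq_bigr => i _; rewrite ?row_mxEl ?row_mxEr.
Qed.

Lemma isom_row_bij : bijective isom_row_fun.
Proof.
exists (fun x : 'rV[R]_(p + q) => (lsubmx x, rsubmx x)).
  by move=> [u v]; rewrite /isom_row_fun row_mxKl row_mxKr.
by move=> x; rewrite /isom_row_fun hsubmxK.
Qed.

Definition isom_row : isom (dsum (euclid R p) (euclid R q)) (euclid R (p + q)) :=
  Isom isom_row_linear isom_row_dot isom_row_bij.

Definition isom_block (f : isom (euclid R p) (euclid R p))
    (g : isom (euclid R q) (euclid R q)) :
    isom (euclid R (p + q)) (euclid R (p + q)) :=
  isom_comp isom_row (isom_comp (isom_dsum f g) (isom_inv isom_row)).

End dsum_row.

End dsum_isom.

Definition sphere (R : realType) (V : ips R) : Type :=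
  one_point_compactification (espace V).
HB.instance Definition _ (R : realType) (V : ips R) :=
  PointedTopological.on (sphere V).

Section sphere.
Variable R : realType.
Implicit Types V W : ips R.

Lemma sphere_pointE V : (point : sphere V) = None.
Proof. by []. Qed.

Definition sphere_map V W (f : isom V W) (a : sphere V) : sphere W :=
  omap (f : V -> W) a.

(* S^V /\ S^W -> S^(V (+) W) *)
Definition sphere_dsum V W (a : sphere V) (b : sphere W) : sphere (dsum V W) :=
  match a, b with
  | Some v, Some w => Some (v, w)
  | _, _ => None
  end.

(* mu_(p,q) : S^p /\ S^q -> S^(p+q) *)
Definition sphere_mu p q (a : sphere (euclid R p)) (b : sphere (euclid R q)) :
  sphere (euclid R (p + q)) := sphere_map (isom_row R p q) (sphere_dsum a b).

Lemma sphere_map_comp V W X (g : isom W X) (f : isom V W) a :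
  sphere_map g (sphere_map f a) = sphere_map (isom_comp g f) a.
Proof. by case: a. Qed.

Lemma sphere_map_id V a : sphere_map (isom_id V) a = a.
Proof. by case: a. Qed.

Lemma sphere_mapK V W (f : isom V W) : cancel (sphere_map f) (sphere_map (isom_inv f)).
Proof. by case=> [v|]//=; congr Some; exact: isomK. Qed.

Lemma sphere_mapKV V W (f : isom V W) : cancel (sphere_map (isom_inv f)) (sphere_map f).
Proof. by case=> [v|]//=; congr Some; exact: isomKV. Qed.

Lemma sphere_map_continuous V W (f : isom V W) : continuous (sphere_map f).
Proof.
case=> [v|] A.
  exact: (@isom_fun_continuous R V W f v (Some @^-1` A)).
move=> [K [cK oK] KA]; exists (f @^-1` K).
  split; last by apply: (closed_comp _ oK) => x _; exact: isom_fun_continuous.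
  rewrite (_ : f @^-1` K = isom_inv f @` K).
    apply: (@continuous_compact (espace W) (espace V) (isom_inv f) K) => //.
    apply: continuous_subspaceT; exact: isom_fun_continuous.
  apply/seteqP; split=> [v Kv|_ [w Kw <-]]/=; last by rewrite isomKV.
  by exists (f v) => //; exact: isomK.
move=> [v [[u /= nKu [<-]]|//]|_]; last by apply: KA; right.
by apply: KA; left; exists (f u).
Qed.

End sphere.

Record orep (R : realType) (G : topGroupType) := Orep {
  orep_space :> ips R;
  rho : G -> isom orep_space orep_space;
  rhoM : forall g h, rho (g * h)%g = isom_comp (rho g) (rho h);
  rho_continuous : continuous rho }.

Section orep.
Variables (R : realType) (G : topGroupType).
Implicit Types V W : orep R G.

Lemma rho1 V : rho V 1%g = isom_id V.
Proof.
apply: isom_eq => v /=.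
have := congr1 (fun f : isom V V => f v) (rhoM V 1%g 1%g).
by rewrite mulg1 /= => /(bij_inj (isom_bij (rho V 1%g))).
Qed.

Lemma otriv_rhoM n (g h : G) :
  isom_id (euclid R n) = isom_comp (isom_id (euclid R n)) (isom_id (euclid R n)).
Proof. exact: isom_eq. Qed.

Definition otriv (n : nat) : orep R G :=
  @Orep R G (euclid R n) (fun=> isom_id (euclid R n)) (otriv_rhoM n)
    (fun g => @cst_continuous G _ _ g).

Section odsum.
Variables V W : orep R G.

Lemma odsum_rhoM g h :
  isom_dsum (rho V (g * h)%g) (rho W (g * h)%g) =
  isom_comp (isom_dsum (rho V g) (rho W g)) (isom_dsum (rho V h) (rho W h)).
Proof. by apply: isom_eq => x; rewrite /= /isom_dsum_fun !rhoM. Qed.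

Lemma odsum_rho_continuous :
  continuous (fun g => isom_dsum (rho V g) (rho W g)).
Proof.
apply: isom_continuousP => -[v w]; apply/enorm_continuousP => g e e0.
have e20 : 0 < e / 2 by rewrite divr_gt0.
have /enorm_continuousP/(_ g _ e20) cv :=
  continuous_cmp (@rho_continuous _ _ V) (@isom_eval_continuous R V V v).
have /enorm_continuousP/(_ g _ e20) cw :=
  continuous_cmp (@rho_continuous _ _ W) (@isom_eval_continuous R W W w).
apply: filterS2 cv cw => h /= hv hw.
set dv := rho V g v - rho V h v; set dw := rho W g w - rho W h w.
rewrite (splitr e); apply: (@le_lt_trans _ _ (enorm dv + enorm dw)); last exact: ltrD.
have sq : enorm ((dv, dw) : dsum V W) ^+ 2 <= (enorm dv + enorm dw) ^+ 2.
  rewrite sqrrD !sqr_enorm /= /pairdot /= addrAC lerDl.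
  by rewrite mulrn_wge0// mulr_ge0 ?enorm_ge0.
by move: sq; rewrite ler_pXn2r// nnegrE ?addr_ge0 ?enorm_ge0.
Qed.

Definition odsum : orep R G :=
  @Orep R G (dsum V W) _ odsum_rhoM odsum_rho_continuous.

End odsum.

Definition orep_iso V W : Prop :=
  exists f : isom V W, forall g v, f (rho V g v) = rho W g (f v).

Definition isom_conj V W (g : G) (f : isom V W) : isom V W :=
  isom_comp (rho W g) (isom_comp f (isom_inv (rho V g))).

End orep.

Arguments otriv {R G} n.

(* R^n is the n-fold direct sum of the one-dimensional trivial representation; in
   particular R^0 is the empty direct sum. *)
Record universe (R : realType) (G : topGroupType) := Universe {
  umem :> orep R G -> Prop;
  umem_triv : forall n, umem (otriv n);
  umem_dsum : forall V W, umem V -> umem W -> umem (odsum V W);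
  umem_summand : forall V V' W, umem W -> orep_iso W (odsum V V') ->
    exists2 V0, umem V0 & orep_iso V V0 }.

Section universe_objects.
Variables (R : realType) (G : topGroupType) (U : universe R G).

Record uob := Uob { uob_rep :> orep R G; uob_mem : U uob_rep }.

Definition utriv n : uob := Uob (umem_triv U n).

Definition udsum (V W : uob) : uob := Uob (umem_dsum (uob_mem V) (uob_mem W)).

End universe_objects.

Arguments utriv {R G U} n.

Record gspace (G : topGroupType) := GSpace {
  gs_space :> ptopologicalType;
  gs_cgwh : cgwh gs_space;
  gact : G -> gs_space -> gs_space;
  gact1 : forall x, gact 1%g x = x;
  gactM : forall g h x, gact (g * h)%g x = gact g (gact h x);
  gact_point : forall g, gact g point = point;
  gact_continuous : continuous (fun z : kprod G gs_space => gact z.1 z.2) }.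

Section gspectra.
Variables (R : realType) (G : topGroupType).

Record gspectrum := GSpectrum {
  lev :> forall n, gspace (G * isom (euclid R n) (euclid R n))%type;
  nu : forall p q, based_map (smash (sphere (euclid R p)) (lev q)) (lev (p + q));
  nu_equiv : forall p q (g : G) (s : isom (euclid R p) (euclid R p))
      (t : isom (euclid R q) (euclid R q)) (a : sphere (euclid R p)) (x : lev q),
    nu p q (smk (sphere_map s a) (gact (g, t) x)) =
    gact (g, isom_block s t) (nu p q (smk a x));
  nu_unit : forall q (x : lev q), nu 0 q (smk (Some 0) x) = x;
  nu_assoc : forall p q r (a : sphere (euclid R p)) (b : sphere (euclid R q))
      (x : lev r),
    nu p (q + r) (smk a (nu q r (smk b x))) =
    ecast n (lev n) (esym (addnA p q r)) (nu (p + q) r (smk (sphere_mu a b) x)) }.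

Record gspectrum_map (X Y : gspectrum) := GSpectrumMap {
  gsm_map :> forall n, based_map (X n) (Y n);
  gsm_equiv : forall n h (x : X n), gsm_map n (gact h x) = gact h (gsm_map n x);
  gsm_nu : forall p q (a : sphere (euclid R p)) (x : X q),
    gsm_map (p + q) (nu X p q (smk a x)) = nu Y p q (smk a (gsm_map q x)) }.

End gspectra.

Section guspectra.
Variables (R : realType) (G : topGroupType) (U : universe R G).

(* Naturality, associativity and the unit laws are stated on elements a /\ x of the
   smash products. If dim V <> dim W then O(V,W) is empty, and O(V,W)_+ is a point. *)
Record guspectrum := GUSpectrum {
  gu_space :> forall V : uob U, gspace G;
  gu_ev : forall V W : uob U,
    based_map (smash (addpt (isom V W)) (gu_space V)) (gu_space W);
  gu_ev_equiv : forall (V W : uob U) g (f : isom V W) (x : gu_space V),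
    gu_ev V W (smk (Some (isom_conj g f)) (gact g x)) =
    gact g (gu_ev V W (smk (Some f) x));
  gu_ev_id : forall (V : uob U) (x : gu_space V),
    gu_ev V V (smk (Some (isom_id V)) x) = x;
  gu_ev_comp : forall (V W Z : uob U) (f : isom W Z) (f' : isom V W)
      (x : gu_space V),
    gu_ev V Z (smk (Some (isom_comp f f')) x) =
    gu_ev W Z (smk (Some f) (gu_ev V W (smk (Some f') x)));
  gu_st : forall V W : uob U,
    based_map (smash (sphere V) (gu_space W)) (gu_space (udsum V W));
  gu_st_equiv : forall (V W : uob U) g (a : sphere V) (x : gu_space W),
    gu_st V W (smk (sphere_map (rho V g) a) (gact g x)) =
    gact g (gu_st V W (smk a x));
  gu_st_nat : forall (V V' W W' : uob U) (f : isom V V') (f' : isom W W')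
      (a : sphere V) (x : gu_space W),
    gu_st V' W' (smk (sphere_map f a) (gu_ev W W' (smk (Some f') x))) =
    gu_ev (udsum V W) (udsum V' W')
      (smk (Some (isom_dsum f f')) (gu_st V W (smk a x)));
  gu_st_unit : forall (W : uob U) (x : gu_space W),
    gu_ev (udsum (utriv 0) W) W
      (smk (Some (isom_unitl W)) (gu_st (utriv 0) W (smk (Some 0) x))) = x;
  gu_st_assoc : forall (V W Z : uob U) (a : sphere V) (b : sphere W)
      (x : gu_space Z),
    gu_st V (udsum W Z) (smk a (gu_st W Z (smk b x))) =
    gu_ev (udsum (udsum V W) Z) (udsum V (udsum W Z))
      (smk (Some (isom_assoc V W Z))
           (gu_st (udsum V W) Z (smk (sphere_dsum a b) x))) }.

Record guspectrum_map (X Y : guspectrum) := GUSpectrumMap {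
  gum_map :> forall V, based_map (X V) (Y V);
  gum_equiv : forall V g (x : X V), gum_map V (gact g x) = gact g (gum_map V x);
  gum_ev : forall (V W : uob U) (f : isom V W) (x : X V),
    gum_map W (gu_ev X V W (smk (Some f) x)) =
    gu_ev Y V W (smk (Some f) (gum_map V x));
  gum_st : forall (V W : uob U) (a : sphere V) (x : X W),
    gum_map (udsum V W) (gu_st X V W (smk a x)) =
    gu_st Y V W (smk a (gum_map W x)) }.

End guspectra.

Record category := Category {
  obj :> Type;
  hom : obj -> obj -> Type;
  idm : forall A, hom A A;
  cmp : forall A B C, hom B C -> hom A B -> hom A C;
  cmp_idl : forall A B (f : hom A B), cmp (idm B) f = f;
  cmp_idr : forall A B (f : hom A B), cmp f (idm A) = f;
  cmpA : forall A B C D (h : hom C D) (g : hom B C) (f : hom A B),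
    cmp h (cmp g f) = cmp (cmp h g) f }.

Record functor (C D : category) := Functor {
  fobj :> C -> D;
  fhom : forall A B : C, hom A B -> hom (fobj A) (fobj B);
  fhom_id : forall A : C, fhom (idm A) = idm (fobj A);
  fhom_cmp : forall (A B E : C) (g : hom B E) (f : hom A B),
    fhom (cmp g f) = cmp (fhom g) (fhom f) }.

Definition functor_id (C : category) : functor C C :=
  @Functor C C id (fun A B f => f) (fun=> erefl) (fun A B E g f => erefl).

Section functor_comp.
Variables (C D E : category) (F' : functor D E) (F : functor C D).

Lemma functor_comp_id A : fhom F' (fhom F (idm A)) = idm (F' (F A)).
Proof. by rewrite !fhom_id. Qed.

Lemma functor_comp_cmp A B B' (g : hom B B') (f : hom A B) :
  fhom F' (fhom F (cmp g f)) = cmp (fhom F' (fhom F g)) (fhom F' (fhom F f)).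
Proof. by rewrite !fhom_cmp. Qed.

Definition functor_comp : functor C E :=
  @Functor C E (fun A => F' (F A)) (fun A B f => fhom F' (fhom F f))
    functor_comp_id functor_comp_cmp.

End functor_comp.

Record nat_trans (C D : category) (F F' : functor C D) := NatTrans {
  nt_map :> forall A : C, hom (F A) (F' A);
  nt_nat : forall (A B : C) (f : hom A B),
    cmp (nt_map B) (fhom F f) = cmp (fhom F' f) (nt_map A) }.

Definition iso (C : category) (A B : C) (f : hom A B) : Prop :=
  exists g : hom B A, cmp g f = idm A /\ cmp f g = idm B.

Definition adjoint_equivalence (C D : category) (F : functor C D)
    (H : functor D C) : Prop :=
  exists (eta : nat_trans (functor_id C) (functor_comp H F))
         (eps : nat_trans (functor_comp F H) (functor_id D)),
    [/\ forall A : C, cmp (eps (F A)) (fhom F (eta A)) = idm (F A),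
        forall B : D, cmp (fhom H (eps B)) (eta (H B)) = idm (H B),
        forall A : C, iso (eta A) &
        forall B : D, iso (eps B)].

Lemma bmap_eq (A B : ptopologicalType) (f g : based_map A B) : f =1 g -> f = g.
Proof.
case: f g => [f cf pf] [g cg pg]/= /funext fg; subst g.
by congr BasedMap; exact: Prop_irrelevance.
Qed.

Definition bmap_id (A : ptopologicalType) : based_map A A :=
  @BasedMap A A id (fun x => @cvg_id _ (nbhs x)) erefl.

Section bmap_comp.
Variables (A B C : ptopologicalType) (g : based_map B C) (f : based_map A B).

Lemma bmap_comp_point : g (f point) = point.
Proof. by rewrite !bmap_point. Qed.

Definition bmap_comp : based_map A C :=
  BasedMap (continuous_cmp (@bmap_continuous _ _ f) (@bmap_continuous _ _ g))
    bmap_comp_point.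

End bmap_comp.

Section gspectrum_category.
Variables (R : realType) (G : topGroupType).
Implicit Types X Y Z : gspectrum R G.

Lemma gsm_eq X Y (f g : gspectrum_map X Y) :
  (forall n x, f n x = g n x) -> f = g.
Proof.
case: f g => [f ef nf] [g eg ng]/= fg.
have : f = g by apply: functional_extensionality_dep => n; exact: bmap_eq.
by move=> ?; subst g; congr GSpectrumMap; exact: Prop_irrelevance.
Qed.

Definition gsm_id X : gspectrum_map X X :=
  @GSpectrumMap R G X X (fun n => bmap_id (X n)) (fun n h x => erefl)
    (fun p q a x => erefl).

Section gsm_comp.
Variables (X Y Z : gspectrum R G) (g : gspectrum_map Y Z) (f : gspectrum_map X Y).

Lemma gsm_comp_equiv n h (x : X n) : g n (f n (gact h x)) = gact h (g n (f n x)).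
Proof. by rewrite !gsm_equiv. Qed.

Lemma gsm_comp_nu p q (a : sphere (euclid R p)) (x : X q) :
  g (p + q) (f (p + q) (nu X p q (smk a x))) = nu Z p q (smk a (g q (f q x))).
Proof. by rewrite !gsm_nu. Qed.

Definition gsm_comp : gspectrum_map X Z :=
  @GSpectrumMap R G X Z (fun n => bmap_comp (g n) (f n)) gsm_comp_equiv gsm_comp_nu.

End gsm_comp.

Lemma gsm_comp_idl X Y (f : gspectrum_map X Y) : gsm_comp (gsm_id Y) f = f.
Proof. exact: gsm_eq. Qed.

Lemma gsm_comp_idr X Y (f : gspectrum_map X Y) : gsm_comp f (gsm_id X) = f.
Proof. exact: gsm_eq. Qed.

Lemma gsm_compA X Y Z T (h : gspectrum_map Z T) (g : gspectrum_map Y Z)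
    (f : gspectrum_map X Y) :
  gsm_comp h (gsm_comp g f) = gsm_comp (gsm_comp h g) f.
Proof. exact: gsm_eq. Qed.

Definition gspectra : category :=
  @Category (gspectrum R G) (@gspectrum_map R G) gsm_id gsm_comp
    gsm_comp_idl gsm_comp_idr gsm_compA.

End gspectrum_category.

Section guspectrum_category.
Variables (R : realType) (G : topGroupType) (U : universe R G).
Implicit Types X Y Z : guspectrum U.

Lemma gum_eq X Y (f g : guspectrum_map X Y) :
  (forall V x, f V x = g V x) -> f = g.
Proof.
case: f g => [f ef nf sf] [g eg ng sg]/= fg.
have : f = g by apply: functional_extensionality_dep => n; exact: bmap_eq.
by move=> ?; subst g; congr GUSpectrumMap; exact: Prop_irrelevance.
Qed.

Definition gum_id X : guspectrum_map X X :=
  @GUSpectrumMap R G U X X (fun V => bmap_id (X V)) (fun V g x => erefl)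
    (fun V W f x => erefl) (fun V W a x => erefl).

Section gum_comp.
Variables (X Y Z : guspectrum U) (g : guspectrum_map Y Z) (f : guspectrum_map X Y).

Lemma gum_comp_equiv V h (x : X V) : g V (f V (gact h x)) = gact h (g V (f V x)).
Proof. by rewrite !gum_equiv. Qed.

Lemma gum_comp_ev (V W : uob U) (k : isom V W) (x : X V) :
  g W (f W (gu_ev X V W (smk (Some k) x))) =
  gu_ev Z V W (smk (Some k) (g V (f V x))).
Proof. by rewrite !gum_ev. Qed.

Lemma gum_comp_st (V W : uob U) (a : sphere V) (x : X W) :
  g (udsum V W) (f (udsum V W) (gu_st X V W (smk a x))) =
  gu_st Z V W (smk a (g W (f W x))).
Proof. by rewrite !gum_st. Qed.

Definition gum_comp : guspectrum_map X Z :=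
  @GUSpectrumMap R G U X Z (fun V => bmap_comp (g V) (f V))
    gum_comp_equiv gum_comp_ev gum_comp_st.

End gum_comp.

Lemma gum_comp_idl X Y (f : guspectrum_map X Y) : gum_comp (gum_id Y) f = f.
Proof. exact: gum_eq. Qed.

Lemma gum_comp_idr X Y (f : guspectrum_map X Y) : gum_comp f (gum_id X) = f.
Proof. exact: gum_eq. Qed.

Lemma gum_compA X Y Z T (h : guspectrum_map Z T) (g : guspectrum_map Y Z)
    (f : guspectrum_map X Y) :
  gum_comp h (gum_comp g f) = gum_comp (gum_comp h g) f.
Proof. exact: gum_eq. Qed.

Definition guspectra : category :=
  @Category (guspectrum U) (@guspectrum_map R G U) gum_id gum_comp
    gum_comp_idl gum_comp_idr gum_compA.

End guspectrum_category.

Section gspace_change.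
Variable G : topGroupType.

Lemma gact_kcont (Y : gspace G) (T : topologicalType) (h : kify T -> G)
    (f : kify T -> Y) :
  continuous h -> continuous f -> continuous (fun t : kify T => gact (h t) (f t)).
Proof.
by move=> ch cf; exact: (kprod_comp ch cf (@gact_continuous G Y)).
Qed.

End gspace_change.

Section beta.
Variables (R : realType) (G : topGroupType) (U : universe R G).

Section beta_obj.
Variable X : guspectrum U.

Local Notation ev f x := (gu_ev X _ _ (smk (Some f) x)).

Lemma isom_conj_triv m n g (f : isom (euclid R m) (euclid R n)) :
  @isom_conj R G (otriv m) (otriv n) g f = f.
Proof.
by apply: isom_eq => v /=; rewrite -[in RHS](isom_invKV (isom_id _) v).
Qed.

Lemma gu_ev_triv m n g (f : isom (euclid R m) (euclid R n)) (x : X (utriv m)) :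
  gact g (gu_ev X (utriv m) (utriv n) (smk (Some f) x)) =
  gu_ev X (utriv m) (utriv n) (smk (Some f) (gact g x)).
Proof. by rewrite -gu_ev_equiv (@isom_conj_triv m n). Qed.

Lemma gu_ev_kcont (V W : uob U) (T : topologicalType) (h : kify T -> isom V W)
    (f : kify T -> X V) :
  continuous h -> continuous f ->
  continuous (fun t : kify T => gu_ev X V W (smk (Some (h t)) (f t))).
Proof.
move=> ch cf.
have c1 := kprod_comp (continuous_cmp ch (@addpt_Some_continuous _)) cf
  (@smk_continuous (addpt (isom V W)) (X V)).
exact: (continuous_cmp c1 (@bmap_continuous _ _ (gu_ev X V W))).
Qed.

Definition beta_act n (h : G * isom (euclid R n) (euclid R n))
    (x : X (utriv n)) : X (utriv n) :=
  gu_ev X (utriv n) (utriv n) (smk (Some h.2) (gact h.1 x)).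

Lemma beta_act1 n (x : X (utriv n)) : beta_act 1%g x = x.
Proof. by rewrite /beta_act gact1 gu_ev_id. Qed.

Lemma beta_actM n g h (x : X (utriv n)) :
  beta_act (g * h)%g x = beta_act g (beta_act h x).
Proof.
by rewrite /beta_act gactM (@gu_ev_triv n n) -(@gu_ev_comp R G U X).
Qed.

Lemma beta_act_point n h : beta_act h (point : X (utriv n)) = point.
Proof. by rewrite /beta_act gact_point smk_ptr bmap_point. Qed.

Lemma beta_act_continuous n :
  continuous (fun z : kprod (G * isom (euclid R n) (euclid R n)) (X (utriv n)) =>
    beta_act z.1 z.2).
Proof.
apply: gu_ev_kcont.
  exact: (continuous_cmp (@kprod_fst _ _) (@continuous_snd _ _)).
apply: gact_kcont; last exact: kprod_snd.
exact: (continuous_cmp (@kprod_fst _ _) (@continuous_fst _ _)).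
Qed.

(* (beta X)_n = X(R^n), on which O(n) = O(R^n,R^n) acts by functoriality *)
Definition beta_space n : gspace (G * isom (euclid R n) (euclid R n))%type :=
  GSpace (gs_cgwh (X (utriv n))) (@beta_act1 n) (@beta_actM n) (@beta_act_point n)
    (@beta_act_continuous n).

(* S^p /\ X(R^q) -> X(R^p (+) R^q) = X(R^(p+q)) *)
Definition beta_nu_fun p q (s : smash (sphere (euclid R p)) (beta_space q)) :
    beta_space (p + q) :=
  gu_ev X (udsum (utriv p) (utriv q)) (utriv (p + q))
    (smk (Some (isom_row R p q)) (gu_st X (utriv p) (utriv q) s)).

Lemma gu_ev_fun_continuous (V W : uob U) (f : isom V W) :
  continuous (fun x : X V => gu_ev X V W (smk (Some f) x)).
Proof.
apply/continuousP => A oA; apply: (gs_cgwh (X V)).1 => K u cK hK cu.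
have ck : continuous (fun x : kify (X V) => gu_ev X V W (smk (Some f) x)).
  by apply: gu_ev_kcont; [exact: cst_continuous | exact: kify_id_continuous].
have := kify_continuous_test ck cK hK cu.
by move=> /continuousP; apply.
Qed.

Lemma beta_nu_continuous p q : continuous (@beta_nu_fun p q).
Proof.
have c1 := @bmap_continuous _ _ (gu_st X (utriv p) (utriv q)).
have c2 := @gu_ev_fun_continuous (udsum (utriv p) (utriv q)) (utriv (p + q))
  (isom_row R p q).
exact: (continuous_cmp c1 c2).
Qed.

Lemma beta_nu_point p q : @beta_nu_fun p q point = point.
Proof. by rewrite /beta_nu_fun bmap_point smk_ptr bmap_point. Qed.

Definition beta_nu p q :
    based_map (smash (sphere (euclid R p)) (beta_space q)) (beta_space (p + q)) :=
  BasedMap (@beta_nu_continuous p q) (@beta_nu_point p q).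

Lemma gu_st_triv_equiv p q g (a : sphere (euclid R p)) (x : X (utriv q)) :
  gact g (gu_st X (utriv p) (utriv q) (smk a x)) =
  gu_st X (utriv p) (utriv q) (smk a (gact g x)).
Proof.
rewrite -[in RHS](sphere_map_id a) -(@gu_st_equiv R G U X (utriv p) (utriv q) g a x).
by [].
Qed.

Lemma isom_conj_row p q g :
  @isom_conj R G (odsum (otriv p) (otriv q)) (otriv (p + q)) g (isom_row R p q) =
  isom_row R p q.
Proof.
apply: isom_eq => v /=.
have := isom_invKV (isom_dsum (isom_id (euclid R p)) (isom_id (euclid R q))) v.
by move=> e; rewrite -[in RHS]e.
Qed.

Lemma beta_nu_equiv p q (g : G) (s : isom (euclid R p) (euclid R p))
    (t : isom (euclid R q) (euclid R q)) (a : sphere (euclid R p))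
    (x : beta_space q) :
  beta_nu p q (smk (sphere_map s a) (gact (g, t) x)) =
  gact (g, isom_block s t) (beta_nu p q (smk a x)).
Proof.
rewrite /= /beta_nu_fun /= /beta_act /=.
rewrite (@gu_st_nat R G U X (utriv p) (utriv p) (utriv q) (utriv q) s t).
rewrite -gu_st_triv_equiv.
have -> y : gact g (gu_ev X (udsum (utriv p) (utriv q)) (utriv (p + q))
    (smk (Some (isom_row R p q)) y)) =
    gu_ev X (udsum (utriv p) (utriv q)) (utriv (p + q))
    (smk (Some (isom_row R p q)) (gact g y)).
  rewrite -(@gu_ev_equiv R G U X (udsum (utriv p) (utriv q)) (utriv (p + q))).
  by rewrite isom_conj_row.
rewrite -!(@gu_ev_comp R G U X).
congr (gu_ev X _ _ (smk (Some _) _)); apply: isom_eq => v /=.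
by congr (isom_row_fun (isom_dsum_fun _ _ _)); rewrite isomK.
Qed.

Lemma beta_nu_unit q (x : beta_space q) : beta_nu 0 q (smk (Some 0) x) = x.
Proof.
have e : isom_row R 0 q =
    isom_unitl (euclid R q) :> isom (dsum (euclid R 0) (euclid R q)) (euclid R q).
  by apply: isom_eq => -[v w]; exact: row_thin_mx.
rewrite -[RHS](@gu_st_unit R G U X (utriv q) x).
exact: (congr1 (fun f : isom (udsum (utriv 0) (utriv q) : uob U) (utriv q : uob U) =>
  gu_ev X (udsum (utriv 0) (utriv q)) (utriv q)
    (smk (Some f) (gu_st X (utriv 0) (utriv q) (smk (Some 0) x)))) e).
Qed.

Lemma beta_cast m n (e : m = n) (x : beta_space m) :
  ecast i (beta_space i) e x =
  gu_ev X (utriv m) (utriv n)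
    (smk (Some (ecast i (isom (euclid R m) (euclid R i)) e (isom_id (euclid R m)))) x).
Proof. by case: n / e; rewrite /= (@gu_ev_id R G U X (utriv m)). Qed.

Lemma ecast_isom m n (e : m = n) (v : 'rV[R]_m) (j : 'I_n) :
  (ecast i (isom (euclid R m) (euclid R i)) e (isom_id (euclid R m)) v : 'rV[R]_n)
    ord0 j = v ord0 (cast_ord (esym e) j).
Proof. by case: n / e j => j /=; congr (v _ _); exact: val_inj. Qed.

Lemma beta_nu_assoc p q r (a : sphere (euclid R p)) (b : sphere (euclid R q))
    (x : beta_space r) :
  beta_nu p (q + r) (smk a (beta_nu q r (smk b x))) =
  ecast n (beta_space n) (esym (addnA p q r))
    (beta_nu (p + q) r (smk (sphere_mu a b) x)).
Proof.
rewrite beta_cast /= /beta_nu_fun.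
rewrite -{1}[a]sphere_map_id.
rewrite (@gu_st_nat R G U X (utriv p) (utriv p) (udsum (utriv q) (utriv r))
  (utriv (q + r))  (isom_id _) (isom_row R q r)).
rewrite (@gu_st_assoc R G U X (utriv p) (utriv q) (utriv r)).
rewrite /sphere_mu -[in RHS](@gu_ev_id R G U X (utriv r) x).
rewrite (@gu_st_nat R G U X (udsum (utriv p) (utriv q)) (utriv (p + q))
  (utriv r) (utriv r)  (isom_row R p q) (isom_id _)).
rewrite -!(@gu_ev_comp R G U X).
congr (gu_ev X _ _ (smk (Some _) _)); apply: isom_eq => -[[u v] w] /=.
apply/rowP => j; rewrite ecast_isom /isom_row_fun /isom_dsum_fun /isom_assoc_fun /=.
by rewrite row_mxA castmxE /= cast_ord_id esymK.
Qed.

Definition beta_obj : gspectrum R G :=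
  GSpectrum beta_nu_equiv beta_nu_unit beta_nu_assoc.

End beta_obj.

Section beta_hom.
Variables (X Y : guspectrum U) (f : guspectrum_map X Y).

Lemma beta_hom_equiv n h (x : beta_obj X n) :
  f (utriv n) (gact h x : beta_obj X n) =
  (gact h (f (utriv n) x : beta_obj Y n) : beta_obj Y n).
Proof.
by rewrite /= /beta_act (@gum_ev R G U X Y f (utriv n) (utriv n)) gum_equiv.
Qed.

Lemma beta_hom_nu p q (a : sphere (euclid R p)) (x : beta_obj X q) :
  f (utriv (p + q)) (nu (beta_obj X) p q (smk a x)) =
  nu (beta_obj Y) p q (smk a (f (utriv q) x)).
Proof.
rewrite /= /beta_nu_fun.
rewrite (@gum_ev R G U X Y f (udsum (utriv p) (utriv q)) (utriv (p + q))).
by rewrite (@gum_st R G U X Y f (utriv p) (utriv q)).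
Qed.

Definition beta_hom : gspectrum_map (beta_obj X) (beta_obj Y) :=
  @GSpectrumMap R G (beta_obj X) (beta_obj Y) (fun n => f (utriv n))
    beta_hom_equiv beta_hom_nu.

End beta_hom.

Lemma beta_hom_id (X : guspectra U) :
  beta_hom (idm X) = idm (beta_obj X : gspectra R G).
Proof. exact: gsm_eq. Qed.

Lemma beta_hom_cmp (X Y Z : guspectra U) (g : hom Y Z) (f : hom X Y) :
  beta_hom (cmp g f) =
  cmp (beta_hom g : @hom (gspectra R G) (beta_obj Y) (beta_obj Z)) (beta_hom f).
Proof. exact: gsm_eq. Qed.

Definition beta : functor (guspectra U) (gspectra R G) :=
  @Functor (guspectra U) (gspectra R G) beta_obj beta_hom beta_hom_id beta_hom_cmp.

End beta.

Lemma kprod_addpt_continuous (T A C : topologicalType)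
    (f : kprod (addpt T) A -> C) (c : C) :
  (forall a, f (None, a) = c) ->
  continuous (fun z : kprod T A => f (Some z.1, z.2)) -> continuous f.
Proof.
move=> fN cf; have [[t0]|nT] := pselect (inhabited T); last first.
  have -> : f = cst c.
    by apply/funext => -[[t|] a] //; case: nT.
  by move=> x; exact: cst_continuous.
apply: kify_continuousP => K u cK hK cu.
pose r (o : addpt T) := if o is Some t then t else t0.
have cr : continuous r.
  apply: addpt_continuous => t; exact: cvg_id.
have cu1 : continuous (fun k => (u k).1) := continuous_cmp cu (@continuous_fst _ _).
have cu2 : continuous (fun k => (u k).2) := continuous_cmp cu (@continuous_snd _ _).
have cg := kify_continuous_test cf cK hK
  (continuous_pair (continuous_cmp cu1 cr) cu2).
apply/continuousP => B oB.
pose N := [set None : addpt T].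
have oN : open N.
  rewrite (_ : open N = open (Some @^-1` N : set T))//.
  by rewrite (_ : _ @^-1` _ = set0) ?openE//; apply/seteqP; split.
have oS : open (~` N).
  rewrite (_ : open _ = open (Some @^-1` (~` N) : set T))//.
  rewrite (_ : _ @^-1` _ = setT); first exact: openT.
  by apply/seteqP; split.
have -> : (fun k => f (u k)) @^-1` B =
    (((fun k => (u k).1) @^-1` (~` N)) `&`
     ((fun k => f (Some (r (u k).1), (u k).2)) @^-1` B)) `|`
    (((fun k => (u k).1) @^-1` N) `&` [set k | B c]).
  apply/seteqP; split=> k /=; case: (u k) => [[t|] a] /=; rewrite ?fN.
  - by move=> H; left.
  - by move=> H; right.
  - by case=> [[_ //]|[//]].
  - by case=> [[H]|[_ //]]; case: H.
move/continuousP : cu1 => cu1; move/continuousP : cg => cg.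
apply: openU; first by apply: openI; [exact: cu1 | exact: cg].
have [Bc|Bc] := pselect (B c).
  rewrite (_ : [set k | B c] = setT) ?setIT; first exact: cu1.
  by apply/seteqP; split.
rewrite (_ : [set k | B c] = set0) ?setI0; first exact: open0.
by apply/seteqP; split.
Qed.

Lemma kify_lift_continuous (A : topologicalType) (T : topologicalType) (h : A -> T) :
  compactly_generated A -> continuous h -> continuous (h : A -> kify T).
Proof.
move=> cgA ch; apply/continuousP => B; rewrite kify_openE => kB.
by apply: cgA => K u cK hK cu; apply: kB => //; exact: continuous_cmp cu ch.
Qed.

Lemma cgwh_homeo (A B : topologicalType) (f : A -> B) (g : B -> A) :
  continuous f -> continuous g -> cancel f g -> cancel g f -> cgwh A -> cgwh B.
Proof.
move=> cf cg fK gK [cgA whA]; split.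
  move=> S kS.
  have oS : open (f @^-1` S).
    apply: cgA => K u cK hK cu.
    exact: (kS K (fun k => f (u k)) cK hK (continuous_cmp cu cf)).
  rewrite (_ : S = g @^-1` (f @^-1` S)); last first.
    by apply/seteqP; split=> x /=; rewrite gK.
  by move/continuousP : cg; exact.
move=> K u cK hK cu.
have cl := whA K (fun k => g (u k)) cK hK (continuous_cmp cu cg).
rewrite (_ : range u = g @^-1` (range (fun k => g (u k)))); last first.
  apply/seteqP; split=> [_ [k _ <-]|x [k _ /= gk]]; first by exists k.
  by exists k => //; apply: (can_inj gK).
by apply: (closed_comp _ cl) => x _; exact: cg.
Qed.

Section alpha_obj.
Variables (R : realType) (G : topGroupType) (X : gspectrum R G).

Section alpha_space.
Variable V : ips R.

Definition alpha_gen
    (s t : smash (addpt (isom (euclid R (dim V)) V)) (X (dim V))) : Prop :=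
  exists (f : isom (euclid R (dim V)) V)
         (k : isom (euclid R (dim V)) (euclid R (dim V))) (x : X (dim V)),
    s = smk (Some (isom_comp f k)) x /\ t = smk (Some f) (gact (1%g, k) x).

(* O(R^n,V)_+ /\_O(n) X_n for n = dim V *)
Definition alpha_space : Type := qspace alpha_gen.
HB.instance Definition _ := PointedTopological.on alpha_space.

Lemma frame_dim n (f : isom (euclid R n) V) : n = dim V.
Proof. exact: etrans (esym (euclid_dim R n)) (isom_dim f). Qed.

(* The class [f, x] of f /\ x; the existence of f forces n = dim V. *)
Definition acls n (f : isom (euclid R n) V) (x : X n) : alpha_space :=
  qpi alpha_gen
    (smk (Some (ecast m (isom (euclid R m) V) (frame_dim f) f))
         (ecast m (X m) (frame_dim f) x)).

Lemma acls_dim (f : isom (euclid R (dim V)) V) (x : X (dim V)) :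
  acls f x = qpi alpha_gen (smk (Some f) x).
Proof. by rewrite /acls (eq_irrelevance (frame_dim f) erefl). Qed.

Lemma acls_gact n (f : isom (euclid R n) V) (k : isom (euclid R n) (euclid R n)) x :
  acls (isom_comp f k) x = acls f (gact (1%g, k) x).
Proof.
have e := frame_dim f; subst n.
by rewrite !acls_dim; apply: qpi_eq; exists f, k, x.
Qed.

Lemma acls_point n (f : isom (euclid R n) V) : acls f point = point.
Proof.
have e := frame_dim f; subst n; rewrite acls_dim.
exact: (congr1 (qpi alpha_gen)
  (smk_ptr (X (dim V)) (Some f : addpt (isom (euclid R (dim V)) V)))).
Qed.

Lemma alphaP (z : alpha_space) : exists x : X (dim V), z = acls (frame V) x.
Proof.
have [s ->] := qpiP z; have [[f|] [x ->]] := smkP s; last first.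
  exists point; rewrite acls_point.
  exact: (congr1 (qpi alpha_gen) (smk_ptl (addpt (isom (euclid R (dim V)) V)) x)).
exists (gact (1%g, isom_comp (isom_inv (frame V)) f) x).
rewrite -acls_gact acls_dim.
have -> // : isom_comp (frame V) (isom_comp (isom_inv (frame V)) f) = f.
by apply: isom_eq => v /=; rewrite isomKV.
Qed.

Lemma acls_change n (f g : isom (euclid R n) V) (x : X n) :
  acls g x = acls f (gact (1%g, isom_comp (isom_inv f) g) x).
Proof.
rewrite -acls_gact; congr acls; apply: isom_eq => v /=; by rewrite isomKV.
Qed.

Definition acoord_fun (f : addpt (isom (euclid R (dim V)) V)) (x : X (dim V)) :
    X (dim V) :=
  if f is Some f then gact (1%g, isom_comp (isom_inv (frame V)) f) x else point.

(* The homeomorphism of alpha_space with X_n given by the isometry frame V, inverse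
   to acls (frame V): acoord_frame, acoordK *)
Definition acoord (z : alpha_space) : X (dim V) :=
  qlift (smash_lift acoord_fun) z.

Lemma acoord_smk f x : smash_lift acoord_fun (smk f x) = acoord_fun f x.
Proof. by apply: smash_liftE => [//|[k|//]]; exact: gact_point. Qed.

Lemma acoord_gen s t :
  alpha_gen s t -> smash_lift acoord_fun s = smash_lift acoord_fun t.
Proof.
case=> f [k [x [-> ->]]]; rewrite !acoord_smk /= -gactM.
congr (gact _ _); congr pair; first by rewrite /= mulg1.
by apply: isom_eq.
Qed.

Lemma acoord_acls (f : isom (euclid R (dim V)) V) x :
  acoord (acls f x) = gact (1%g, isom_comp (isom_inv (frame V)) f) x.
Proof.
by rewrite acls_dim /acoord qliftE ?acoord_smk//; exact: acoord_gen.
Qed.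

Lemma frame_inv_comp : isom_comp (isom_inv (frame V)) (frame V) = 1%g.
Proof. by apply: isom_eq => v /=; rewrite isomK. Qed.

Lemma acoord_frame x : acoord (acls (frame V) x) = x.
Proof. by rewrite acoord_acls frame_inv_comp gact1. Qed.

Lemma acoordK z : acls (frame V) (acoord z) = z.
Proof. by have [x ->] := alphaP z; rewrite acoord_frame. Qed.

Lemma acoord_point : acoord point = point.
Proof. by rewrite -(acls_point (frame V)) acoord_frame. Qed.

Lemma acoord_continuous : continuous acoord.
Proof.
apply: qlift_continuous; first exact: acoord_gen.
apply: smash_continuous; apply: (@kprod_addpt_continuous _ _ _ _ point) => /=.
  by move=> a; rewrite acoord_smk.
rewrite (_ : (fun z => _) = (fun z : kprod (isom (euclid R (dim V)) V) (X (dim V)) =>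
  gact (1%g, isom_comp (isom_inv (frame V)) z.1) z.2)); last first.
  by apply/funext => z; rewrite acoord_smk.
apply: gact_kcont; last exact: kprod_snd.
apply: continuous_pair; first exact: cst_continuous.
apply: isom_continuousP => v.
have c1 := continuous_cmp (@kprod_fst _ (X (dim V))) (@isom_eval_continuous R _ V v).
exact: (continuous_cmp c1 (@isom_fun_continuous R _ _ (isom_inv (frame V)))).
Qed.

Lemma acls_continuous n (f : isom (euclid R n) V) : continuous (acls f).
Proof.
have e := frame_dim f; subst n.
have c1 : continuous (fun x : X (dim V) =>
    (Some f, x) : kprod (addpt (isom (euclid R (dim V)) V)) (X (dim V))).
  apply: (@kify_lift_continuous _
    (addpt (isom (euclid R (dim V)) V) * X (dim V))%type); first exact: (gs_cgwh _).1.
  by apply: continuous_pair; [exact: cst_continuous | move=> x; exact: cvg_id].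
have c2 := continuous_cmp c1 (@smk_continuous _ _).
have c3 := continuous_cmp c2 (@qpi_continuous _ alpha_gen).
by rewrite (_ : acls f = (fun x => qpi alpha_gen (smk (Some f) x)))//;
  apply/funext => x; rewrite acls_dim.
Qed.

Lemma alpha_cgwh : cgwh alpha_space.
Proof.
apply: (cgwh_homeo (@acls_continuous _ (frame V)) acoord_continuous
  acoord_frame acoordK); exact: gs_cgwh.
Qed.

Lemma acls_kcont n (T : topologicalType) (h : kify T -> isom (euclid R n) V)
    (f : kify T -> X n) :
  continuous h -> continuous f -> continuous (fun t : kify T => acls (h t) (f t)).
Proof.
move=> ch cf; have [[g]|nV] := pselect (inhabited (isom (euclid R n) V)); last first.
  by move=> t; case: nV; exact: inhabits (h t).
rewrite (_ : (fun t => _) = (fun t : kify T =>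
  acls g (gact (1%g, isom_comp (isom_inv g) (h t)) (f t)))); last first.
  by apply/funext => t; exact: acls_change.
have c1 : continuous (fun t : kify T =>
    gact (1%g, isom_comp (isom_inv g) (h t)) (f t)).
  apply: gact_kcont cf; apply: continuous_pair; first exact: cst_continuous.
  apply: isom_continuousP => v.
  have c1 := continuous_cmp ch (@isom_eval_continuous R _ V v).
  exact: (continuous_cmp c1 (@isom_fun_continuous R _ _ (isom_inv g))).
exact: (continuous_cmp c1 (@acls_continuous n g)).
Qed.

End alpha_space.

Section alpha_action.
Variable V : orep R G.

(* The diagonal action g [f, x] = [rho(g) o f, g x]: agact_acls *)
Definition agact (g : G) (z : alpha_space V) : alpha_space V :=
  acls (isom_comp (rho V g) (frame V)) (gact (g, 1%g) (acoord z)).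

Lemma agact_acls g n (f : isom (euclid R n) V) (x : X n) :
  agact g (acls f x) = acls (isom_comp (rho V g) f) (gact (g, 1%g) x).
Proof.
have e := frame_dim f; subst n.
rewrite /agact acoord_acls -gactM.
rewrite [RHS](acls_change (isom_comp (rho V g) (frame V))) -gactM.
congr (acls _ (gact _ _)); congr pair; first by rewrite /= mulg1 mul1g.
rewrite /= mulg1 mul1g; apply: isom_eq => v /=.
apply: (bij_inj (isom_bij (isom_comp (rho V g) (frame V)))).
by rewrite isomKV /= isomKV.
Qed.

Lemma agact1 z : agact 1%g z = z.
Proof.
have [x ->] := alphaP z; rewrite agact_acls gact1 rho1.
by congr acls; exact: isom_eq.
Qed.

Lemma agactM g h z : agact (g * h)%g z = agact g (agact h z).
Proof.
have [x ->] := alphaP z; rewrite !agact_acls -gactM rhoM.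
congr (acls _ (gact _ _)); last by congr pair; rewrite /= mulg1.
by apply: isom_eq.
Qed.

Lemma agact_point g : agact g point = point.
Proof. by rewrite /agact acoord_point gact_point acls_point. Qed.

Lemma agact_continuous :
  continuous (fun z : kprod G (alpha_space V) => agact z.1 z.2).
Proof.
apply: acls_kcont.
  apply: isom_continuousP => v.
  have c1 := continuous_cmp (@kprod_fst G (alpha_space V)) (@rho_continuous _ _ V).
  exact: (continuous_cmp c1 (@isom_eval_continuous R V V (frame V v))).
apply: gact_kcont.
  by apply: continuous_pair; [exact: kprod_fst | exact: cst_continuous].
exact: (continuous_cmp (@kprod_snd _ _) (@acoord_continuous V)).
Qed.

Definition alpha_gspace : gspace G :=
  GSpace (alpha_cgwh V) agact1 agactM agact_point agact_continuous.

End alpha_action.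

Section alpha_ev.
Variables V W : orep R G.

Definition aev_fun (f : addpt (isom V W)) (z : alpha_gspace V) : alpha_gspace W :=
  if f is Some f then acls (isom_comp f (frame V)) (acoord z) else point.

Definition aev_map : smash (addpt (isom V W)) (alpha_gspace V) -> alpha_gspace W :=
  smash_lift aev_fun.

Lemma aev_smk f z : aev_map (smk f z) = aev_fun f z.
Proof.
apply: smash_liftE => [//|[k|//]] /=.
by rewrite acoord_point acls_point.
Qed.

Lemma aev_acls (f : isom V W) n (h : isom (euclid R n) V) (x : X n) :
  aev_map (smk (Some f) (acls h x)) = acls (isom_comp f h) x.
Proof.
have e := frame_dim h; subst n.
rewrite aev_smk /= acoord_acls [RHS](acls_change (isom_comp f (frame V))).
congr (acls _ (gact _ _)); congr pair; apply: isom_eq => v /=.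
apply: (bij_inj (isom_bij (isom_comp f (frame V)))).
by rewrite isomKV /= isomKV.
Qed.

Lemma aev_continuous : continuous aev_map.
Proof.
apply: smash_continuous; apply: (@kprod_addpt_continuous _ _ _ _ point) => /=.
  by move=> a; rewrite aev_smk.
rewrite (_ : (fun z => _) = (fun z : kprod (isom V W) (alpha_gspace V) =>
  acls (isom_comp z.1 (frame V)) (acoord z.2))); last first.
  by apply/funext => z; rewrite aev_smk.
apply: acls_kcont.
  apply: isom_continuousP => v.
  exact: (continuous_cmp (@kprod_fst _ _) (@isom_eval_continuous R V W (frame V v))).
exact: (continuous_cmp (@kprod_snd _ _) (@acoord_continuous V)).
Qed.

Lemma aev_point : aev_map point = point.
Proof. by rewrite -(smk_ptl (addpt (isom V W)) (point : alpha_gspace V)) aev_smk. Qed.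

(* tau /\ [f, x] |-> [tau o f, x]: aev_acls *)
Definition aev :
    based_map (smash (addpt (isom V W)) (alpha_gspace V)) (alpha_gspace W) :=
  BasedMap aev_continuous aev_point.

End alpha_ev.

Section alpha_st.
Variables V W : orep R G.

Local Notation p := (dim V).
Local Notation q := (dim W).

Definition ast_fun (a : sphere V) (z : alpha_gspace W) :
    alpha_gspace (odsum V W) :=
  acls (isom_comp (isom_dsum (frame V) (frame W)) (isom_inv (isom_row R p q)))
    (nu X p q (smk (sphere_map (isom_inv (frame V)) a) (acoord z))).

Definition ast_map : smash (sphere V) (alpha_gspace W) -> alpha_gspace (odsum V W) :=
  smash_lift ast_fun.

Lemma ast_smk a z : ast_map (smk a z) = ast_fun a z.
Proof.
apply: smash_liftE => [{}z|{}a]; rewrite /ast_fun.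
  by rewrite (bmap_smk_ptl (nu X p q)) acls_point.
by rewrite acoord_point (bmap_smk_ptr (nu X p q)) acls_point.
Qed.

Lemma ast_acls m n (f : isom (euclid R m) V) (h : isom (euclid R n) W)
    (a : sphere (euclid R m)) (x : X n) :
  ast_map (smk (sphere_map f a) (acls h x)) =
  acls (isom_comp (isom_dsum f h) (isom_inv (isom_row R m n)))
    (nu X m n (smk a x)).
Proof.
have e := frame_dim f; subst m; have e := frame_dim h; subst n.
rewrite ast_smk /ast_fun acoord_acls sphere_map_comp nu_equiv.
rewrite -acls_gact; congr acls; apply: isom_eq => v /=.
rewrite -[in RHS](isomKV (isom_row R p q) v) isomK.
rewrite -[in LHS](isomKV (isom_row R p q) v) !isomK.
by rewrite /isom_dsum_fun /= !isomKV.
Qed.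

Lemma ast_continuous : continuous ast_map.
Proof.
apply: smash_continuous.
rewrite (_ : (fun z => _) = (fun z : kprod (sphere V) (alpha_gspace W) =>
  ast_fun z.1 z.2)); last by apply/funext => z; rewrite ast_smk.
apply: acls_kcont; first exact: cst_continuous.
have c1 := continuous_cmp (@kprod_fst (sphere V) (alpha_gspace W))
  (@sphere_map_continuous R _ _ (isom_inv (frame V))).
have c2 := continuous_cmp (@kprod_snd (sphere V) (alpha_gspace W))
  (@acoord_continuous W).
have c3 := kprod_comp c1 c2 (@smk_continuous _ _).
exact: (continuous_cmp c3 (@bmap_continuous _ _ (nu X p q))).
Qed.

Lemma ast_point : ast_map point = point.
Proof.
rewrite -(smk_ptr (alpha_gspace W) (point : sphere V)) ast_smk /ast_fun.
by rewrite acoord_point (bmap_smk_ptr (nu X p q)) acls_point.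
Qed.

(* a /\ [h, x] |-> [(f (+) h) o (R^(p+q) = R^p (+) R^q), nu_(p,q) (f^-1 a /\ x)] for
   any isometry f : R^p -> V: ast_acls *)
Definition ast :
    based_map (smash (sphere V) (alpha_gspace W)) (alpha_gspace (odsum V W)) :=
  BasedMap ast_continuous ast_point.

End alpha_st.

Section alpha_spectrum.
Variable U : universe R G.

Definition alpha_lev (V : uob U) : gspace G := alpha_gspace V.

Definition alpha_ev (V W : uob U) :
  based_map (smash (addpt (isom V W)) (alpha_lev V)) (alpha_lev W) := aev V W.

Definition alpha_st (V W : uob U) :
  based_map (smash (sphere V) (alpha_lev W)) (alpha_lev (udsum V W)) := ast V W.

Lemma alpha_ev_equiv (V W : uob U) g (f : isom V W) (x : alpha_lev V) :
  alpha_ev V W (smk (Some (isom_conj g f)) (gact g x)) =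
  gact g (alpha_ev V W (smk (Some f) x)).
Proof.
have [y ->] := alphaP x; rewrite /= agact_acls !aev_acls agact_acls.
by congr acls; apply: isom_eq => v /=; rewrite isomK.
Qed.

Lemma alpha_ev_id (V : uob U) (x : alpha_lev V) :
  alpha_ev V V (smk (Some (isom_id V)) x) = x.
Proof.
by have [y ->] := alphaP x; rewrite /= aev_acls; congr acls; exact: isom_eq.
Qed.

Lemma alpha_ev_comp (V W Z : uob U) (f : isom W Z) (f' : isom V W)
    (x : alpha_lev V) :
  alpha_ev V Z (smk (Some (isom_comp f f')) x) =
  alpha_ev W Z (smk (Some f) (alpha_ev V W (smk (Some f') x))).
Proof.
by have [y ->] := alphaP x; rewrite /= !aev_acls; congr acls; exact: isom_eq.
Qed.

Lemma sphere_frame (V : ips R) (a : sphere V) :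
  exists b, a = sphere_map (frame V) b.
Proof. by exists (sphere_map (isom_inv (frame V)) a); rewrite sphere_mapKV. Qed.

Lemma isom_block_id p q :
  isom_block (isom_id (euclid R p)) (isom_id (euclid R q)) = isom_id _.
Proof.
apply: isom_eq => v; rewrite -[in RHS](isomKV (isom_row R p q) v) /=.
by move: (isom_inv_fun (isom_row R p q) v) => -[].
Qed.

Lemma nu_gequiv p q g (a : sphere (euclid R p)) (x : X q) :
  nu X p q (smk a (gact (g, 1%g) x)) = gact (g, 1%g) (nu X p q (smk a x)).
Proof.
by rewrite -[in LHS](sphere_map_id a) nu_equiv isom_block_id.
Qed.

Lemma alpha_st_equiv (V W : uob U) g (a : sphere V) (x : alpha_lev W) :
  alpha_st V W (smk (sphere_map (rho V g) a) (gact g x)) =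
  gact g (alpha_st V W (smk a x)).
Proof.
have [y ->] := alphaP x; have [b ->] := sphere_frame a.
rewrite /= agact_acls sphere_map_comp !ast_acls agact_acls nu_gequiv.
by congr acls; exact: isom_eq.
Qed.

Lemma alpha_st_nat (V V' W W' : uob U) (f : isom V V') (f' : isom W W')
    (a : sphere V) (x : alpha_lev W) :
  alpha_st V' W' (smk (sphere_map f a) (alpha_ev W W' (smk (Some f') x))) =
  alpha_ev (udsum V W) (udsum V' W')
    (smk (Some (isom_dsum f f')) (alpha_st V W (smk a x))).
Proof.
have [y ->] := alphaP x; have [b ->] := sphere_frame a.
rewrite /= aev_acls sphere_map_comp !ast_acls.
rewrite (@aev_acls (odsum V W) (odsum V' W')).
by congr acls; exact: isom_eq.
Qed.

Lemma alpha_st_unit (W : uob U) (x : alpha_lev W) :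
  alpha_ev (udsum (utriv 0) W) W
    (smk (Some (isom_unitl W)) (alpha_st (utriv 0) W (smk (Some 0) x))) = x.
Proof.
have [y ->] := alphaP x.
rewrite /alpha_ev /alpha_st /=.
have -> : (Some 0 : sphere (euclid R 0)) =
    sphere_map (isom_id (euclid R 0)) (Some 0) by [].
rewrite (@ast_acls (otriv 0) W 0 (dim W) (isom_id (euclid R 0)) (frame W) (Some 0) y).
rewrite nu_unit (@aev_acls (odsum (otriv 0) W) W).
congr acls; apply: isom_eq => v /=; rewrite /isom_unitl_fun /=.
congr (frame W _); rewrite -[RHS](isomKV (isom_row R 0 (dim W)) v) /=.
by rewrite /isom_row_fun row_thin_mx.
Qed.

Lemma acls_cast (V : ips R) m n (e : m = n) (f : isom (euclid R m) V) (x : X m) :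
  acls (ecast i (isom (euclid R i) V) e f) (ecast i (X i) e x) = acls f x.
Proof. by case: n / e. Qed.

Lemma ecast_isom_src (V : ips R) m n (e : m = n) (f : isom (euclid R m) V)
    (v : 'rV[R]_n) :
  ecast i (isom (euclid R i) V) e f v = f (castmx (erefl 1, esym e) v).
Proof. by case: n / e v => v; rewrite castmx_id. Qed.

Lemma alpha_st_assoc (V W Z : uob U) (a : sphere V) (b : sphere W)
    (x : alpha_lev Z) :
  alpha_st V (udsum W Z) (smk a (alpha_st W Z (smk b x))) =
  alpha_ev (udsum (udsum V W) Z) (udsum V (udsum W Z))
    (smk (Some (isom_assoc V W Z))
         (alpha_st (udsum V W) Z (smk (sphere_dsum a b) x))).
Proof.
have [y ->] := alphaP x; have [a' ->] := sphere_frame a.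
have [b' ->] := sphere_frame b.
have -> : sphere_dsum (sphere_map (frame V) a') (sphere_map (frame W) b') =
    sphere_map (isom_comp (isom_dsum (frame V) (frame W))
      (isom_inv (isom_row R (dim V) (dim W)))) (sphere_mu a' b').
  case: a' b' => [u|] [w|] //=; congr Some.
  by rewrite [isom_inv_fun _ _](isomK (isom_row R (dim V) (dim W))).
rewrite /= (@ast_acls W Z) (@ast_acls V (odsum W Z)) (@ast_acls (odsum V W) Z).
rewrite (@aev_acls (odsum (odsum V W) Z) (odsum V (odsum W Z))).
rewrite nu_assoc -[RHS](acls_cast (esym (addnA (dim V) (dim W) (dim Z)))).
congr acls; apply: isom_eq => v; rewrite ecast_isom_src esymK.
set p := dim V; set q := dim W; set r := dim Z.
have [[u1 [u2 u3]] ev] : exists u : dsum (euclid R p) (dsum (euclid R q) (euclid R r)),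
    v = isom_row R p (q + r) (u.1, isom_row R q r u.2).
  exists ((isom_inv (isom_row R p (q + r)) v).1,
    isom_inv (isom_row R q r) (isom_inv (isom_row R p (q + r)) v).2).
  rewrite /= [isom_row_fun (isom_inv_fun _ _)](isomKV (isom_row R q r)).
  rewrite -[LHS](isomKV (isom_row R p (q + r)) v) /=.
  by move: (isom_inv_fun (isom_row R p (q + r)) v) => -[].
have -> : castmx (erefl 1%N, addnA p q r) v =
    isom_row R (p + q) r (isom_row R p q (u1, u2), u3).
  rewrite ev /= /isom_row_fun /= row_mxA castmx_comp castmx_id.
  by [].
by rewrite ev /= !isomK /= /isom_dsum_fun /= !isomK.
Qed.

Definition alpha_obj : guspectrum U :=
  GUSpectrum alpha_ev_equiv alpha_ev_id alpha_ev_comp alpha_st_equiv alpha_st_nat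
    alpha_st_unit alpha_st_assoc.

End alpha_spectrum.

End alpha_obj.

Section alpha.
Variables (R : realType) (G : topGroupType) (U : universe R G).

Section alpha_hom.
Variables (X Y : gspectrum R G) (f : gspectrum_map X Y).

(* [h, x] |-> [h, f x]: alpha_hom_acls *)
Definition alpha_hom_fun (V : ips R) (z : alpha_space X V) : alpha_space Y V :=
  acls (frame V) (f (dim V) (acoord z)).

Lemma alpha_hom_acls (V : ips R) n (h : isom (euclid R n) V) (x : X n) :
  alpha_hom_fun (acls h x) = acls h (f n x).
Proof.
have e := frame_dim h; subst n.
by rewrite /alpha_hom_fun acoord_acls gsm_equiv -acls_change.
Qed.

Lemma alpha_hom_continuous (V : ips R) : continuous (@alpha_hom_fun V).
Proof.
have c1 := continuous_cmp (@acoord_continuous _ _ X V)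
  (@bmap_continuous _ _ (f (dim V))).
exact: (continuous_cmp c1 (@acls_continuous _ _ Y V _ (frame V))).
Qed.

Lemma alpha_hom_point (V : ips R) : @alpha_hom_fun V point = point.
Proof. by rewrite /alpha_hom_fun acoord_point bmap_point acls_point. Qed.

Definition alpha_hom_map (V : uob U) : based_map (alpha_obj X U V) (alpha_obj Y U V) :=
  @BasedMap (alpha_obj X U V) (alpha_obj Y U V) (@alpha_hom_fun V)
    (@alpha_hom_continuous V) (@alpha_hom_point V).

Lemma alpha_hom_equiv (V : uob U) g (x : alpha_obj X U V) :
  alpha_hom_map V (gact g x) = gact g (alpha_hom_map V x).
Proof.
have [y ->] := alphaP x.
by rewrite /= agact_acls !alpha_hom_acls agact_acls gsm_equiv.
Qed.

Lemma alpha_hom_ev (V W : uob U) (k : isom V W) (x : alpha_obj X U V) :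
  alpha_hom_map W (gu_ev (alpha_obj X U) V W (smk (Some k) x)) =
  gu_ev (alpha_obj Y U) V W (smk (Some k) (alpha_hom_map V x)).
Proof.
by have [y ->] := alphaP x; rewrite /= aev_acls !alpha_hom_acls aev_acls.
Qed.

Lemma alpha_hom_st (V W : uob U) (a : sphere V) (x : alpha_obj X U W) :
  alpha_hom_map (udsum V W) (gu_st (alpha_obj X U) V W (smk a x)) =
  gu_st (alpha_obj Y U) V W (smk a (alpha_hom_map W x)).
Proof.
have [y ->] := alphaP x; have [b ->] := sphere_frame a.
by rewrite /= ast_acls !alpha_hom_acls ast_acls gsm_nu.
Qed.

Definition alpha_hom : guspectrum_map (alpha_obj X U) (alpha_obj Y U) :=
  GUSpectrumMap alpha_hom_equiv alpha_hom_ev alpha_hom_st.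

End alpha_hom.

Lemma alpha_hom_id (X : gspectra R G) :
  alpha_hom (idm X) = idm (alpha_obj X U : guspectra U).
Proof.
apply: gum_eq => V x; have [y ->] := alphaP x.
exact: (@alpha_hom_acls X X (gsm_id X) V _ (frame V) y).
Qed.

Lemma alpha_hom_cmp (X Y Z : gspectra R G) (g : hom Y Z) (f : hom X Y) :
  alpha_hom (cmp g f) =
  cmp (alpha_hom g : @hom (guspectra U) (alpha_obj Y U) (alpha_obj Z U)) (alpha_hom f).
Proof.
apply: gum_eq => V x; have [y ->] := alphaP x.
by rewrite /= !alpha_hom_acls.
Qed.

Definition alpha : functor (gspectra R G) (guspectra U) :=
  @Functor (gspectra R G) (guspectra U) (fun X => alpha_obj X U) alpha_hom
    alpha_hom_id alpha_hom_cmp.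

End alpha.

(* Main.v *)
Require Import Defs.
From mathcomp Require Import all_boot all_order all_algebra.
From mathcomp Require Import all_classical all_reals all_analysis.
Set Implicit Arguments.
Unset Strict Implicit.
Unset Printing Implicit Defensive.

(** The unit is [x |-> [id, x]], from [X_n] to [O(R^n, R^n)_+ /\_O(n) X_n], and the
    counit is the evaluation [[f, y] |-> Y(f) y], from
    [O(R^n, V)_+ /\_O(n) Y(R^n)] to [Y(V)].  Any isometry [f : R^n -> V] gives a
    homeomorphism [x |-> [f, x]] from [X_n] to [(alpha X)(V)], so the unit is a
    levelwise homeomorphism; conjugating with a frame of [V] shows that the counit
    is one too.  Both inverses are automatically maps of spectra. *)

(** * Levelwise homeomorphisms and isomorphisms of spectra *)

Section levelwise_iso.
Variables (R : realType) (G : topGroupType).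

(** Each [f n] is injective, so an equation for the inverses can be checked after applying [f n],
    where it becomes the corresponding equation for [f]. *)
Lemma gspectra_iso (X Y : gspectrum R G) (f : gspectrum_map X Y) :
  (forall n, exists g : Y n -> X n,
     [/\ continuous g, cancel (f n) g & cancel g (f n)]) ->
  @iso (gspectra R G) X Y f.
Proof.
move=> ex; pose g n := projT1 (cid (ex n)).
have gE n : [/\ continuous (g n), cancel (f n) (g n) & cancel (g n) (f n)].
  exact: projT2 (cid (ex n)).
have cg n : continuous (g n) by case: (gE n).
have fK n : cancel (f n) (g n) by case: (gE n).
have gK n : cancel (g n) (f n) by case: (gE n).
have gpt n : g n point = point by rewrite -(bmap_point (f n)) fK.
have gequiv n h (y : Y n) : g n (gact h y) = gact h (g n y).
  by apply: (can_inj (fK n)); rewrite gsm_equiv !gK.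
have gnu p q (a : sphere (euclid R p)) (y : Y q) :
    g (p + q)%N (nu Y p q (smk a y)) = nu X p q (smk a (g q y)).
  by apply: (can_inj (fK (p + q)%N)); rewrite gsm_nu !gK.
exists (@GSpectrumMap R G Y X (fun n => BasedMap (cg n) (gpt n)) gequiv gnu).
by split; apply: gsm_eq => n x; [exact: fK | exact: gK].
Qed.

Lemma guspectra_iso (U : universe R G) (X Y : guspectrum U)
    (f : guspectrum_map X Y) :
  (forall V, exists g : Y V -> X V,
     [/\ continuous g, cancel (f V) g & cancel g (f V)]) ->
  @iso (guspectra U) X Y f.
Proof.
move=> ex; pose g V := projT1 (cid (ex V)).
have gE V : [/\ continuous (g V), cancel (f V) (g V) & cancel (g V) (f V)].
  exact: projT2 (cid (ex V)).
have cg V : continuous (g V) by case: (gE V).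
have fK V : cancel (f V) (g V) by case: (gE V).
have gK V : cancel (g V) (f V) by case: (gE V).
have gpt V : g V point = point by rewrite -(bmap_point (f V)) fK.
have gequiv V h (y : Y V) : g V (gact h y) = gact h (g V y).
  by apply: (can_inj (fK V)); rewrite gum_equiv !gK.
have gev (V W : uob U) (k : isom V W) (y : Y V) :
    g W (gu_ev Y V W (smk (Some k) y)) = gu_ev X V W (smk (Some k) (g V y)).
  by apply: (can_inj (fK W)); rewrite gum_ev !gK.
have gst (V W : uob U) (a : sphere V) (y : Y W) :
    g (udsum V W) (gu_st Y V W (smk a y)) = gu_st X V W (smk a (g W y)).
  by apply: (can_inj (fK (udsum V W))); rewrite gum_st !gK.
exists (@GUSpectrumMap R G U Y X (fun V => BasedMap (cg V) (gpt V)) gequiv gev gst).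
by split; apply: gum_eq => V x; [exact: fK | exact: gK].
Qed.

End levelwise_iso.

(** The coordinate [acoord] refers to the chosen frame of [V]; the element
    [isom_comp (isom_inv f) (frame V)] of O(n) converts it to the coordinate given by [f]. Keeping
    [n] apart from [dim V] lets the lemma apply directly to the identity of R^n. *)
Lemma acls_homeo (R : realType) (G : topGroupType) (X : gspectrum R G) (V : ips R)
    n (f : isom (euclid R n) V) :
  exists g : alpha_space X V -> X n,
    [/\ continuous g, cancel (@acls R G X V n f) g & cancel g (@acls R G X V n f)].
Proof.
have e := frame_dim f; subst n.
have fK : cancel (@acls R G X V _ f)
    (fun z => gact (1%g, isom_comp (isom_inv f) (frame V)) (acoord z)).
  move=> x; rewrite acoord_acls -gactM -[RHS]gact1.
  congr (gact _ _); congr pair; first by rewrite /= mulg1.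
  by apply: isom_eq => v /=; rewrite isomKV isomK.
have gK z : acls f
    (gact (1%g, isom_comp (isom_inv f) (frame V)) (acoord z) : X (dim V)) = z.
  by rewrite -acls_change acoordK.
exists (fun z => gact (1%g, isom_comp (isom_inv f) (frame V)) (acoord z)); split=> //.
have cact : continuous (fun x : X (dim V) =>
    gact (1%g, isom_comp (isom_inv f) (frame V)) x).
  (* Joint continuity of the action is known on the k-ified product, which gives continuity on
     [kify (X (dim V))]; compact generation carries it over to the original topology. *)
  apply/continuousP => A oA; apply: (gs_cgwh (X (dim V))).1 => K u cK hK cu.
  have ck : continuous (fun x : kify (X (dim V)) =>
      gact (1%g, isom_comp (isom_inv f) (frame V)) (x : X (dim V))).
    by apply: gact_kcont; [exact: cst_continuous | exact: kify_id_continuous].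
  by have /continuousP := kify_continuous_test ck cK hK cu; apply.
exact: (continuous_cmp (@acoord_continuous R G X V) cact).
Qed.

(** * The unit *)

Section unit.
Variables (R : realType) (G : topGroupType) (U : universe R G).

Section unit_map.
Variable X : gspectrum R G.

Local Notation BA := (beta_obj (alpha_obj X U)).

(** The identity replaces [frame (euclid R n)], an arbitrary choice for which the map need not
    respect the O(n)-actions. *)
Definition unit_fun n (x : X n) : BA n := acls (isom_id (euclid R n)) x.

Lemma unit_continuous n : continuous (@unit_fun n).
Proof. exact: acls_continuous. Qed.

Lemma unit_point n : @unit_fun n point = point.
Proof. exact: acls_point. Qed.

Definition unit_map n : based_map (X n) (BA n) :=
  BasedMap (@unit_continuous n) (@unit_point n).

Lemma unit_equiv n h (x : X n) : unit_map n (gact h x) = gact h (unit_map n x).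
Proof.
case: h => g k; rewrite /= /unit_fun /beta_act /=.
rewrite (@agact_acls R G X (otriv n)) (@aev_acls R G X (otriv n) (otriv n)).
(* With [k] on the right of the identity, the relation of the balanced product moves it onto [x]. *)
rewrite (_ : isom_comp k _ = isom_comp (isom_id _) k); last exact: isom_eq.
rewrite acls_gact -gactM; congr (acls _ (gact _ _)).
by congr pair; rewrite /= ?mul1g ?mulg1.
Qed.

Lemma unit_nu p q (a : sphere (euclid R p)) (x : X q) :
  unit_map (p + q) (nu X p q (smk a x)) = nu BA p q (smk a (unit_map q x)).
Proof.
rewrite /= /unit_fun /beta_nu_fun /= -[in RHS](sphere_map_id a).
rewrite (@ast_acls R G X (otriv p) (otriv q)).
rewrite (@aev_acls R G X (odsum (otriv p) (otriv q)) (otriv (p + q))).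
(* The isometry [isom_row] in the structure map of beta cancels its inverse in that of alpha. *)
by congr acls; apply: isom_eq => v /=; rewrite -[LHS](isomKV (isom_row R p q)).
Qed.

Definition unit_hom : gspectrum_map X BA := GSpectrumMap unit_equiv unit_nu.

Lemma unit_iso : @iso (gspectra R G) X BA unit_hom.
Proof. by apply: gspectra_iso => n; exact: acls_homeo. Qed.

End unit_map.

Lemma unit_natural (X Y : gspectrum R G) (f : gspectrum_map X Y) :
  gsm_comp (unit_hom Y) f = gsm_comp (beta_hom (alpha_hom U f)) (unit_hom X).
Proof.
by apply: gsm_eq => n x; rewrite /= /unit_fun alpha_hom_acls.
Qed.

End unit.

(** * The counit *)

Lemma gu_ev_eq (R : realType) (G : topGroupType) (U : universe R G)
    (Y : guspectrum U) (V W : uob U) (f f' : isom V W) (y : Y V) :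
  f =1 f' -> gu_ev Y V W (smk (Some f) y) = gu_ev Y V W (smk (Some f') y).
Proof. by move=> /isom_eq ->. Qed.

Section counit.
Variables (R : realType) (G : topGroupType) (U : universe R G).

Section counit_map.
Variable Y : guspectrum U.

Local Notation AB := (alpha_obj (beta_obj Y) U).

Definition counit_fun (V : uob U) (z : AB V) : Y V :=
  gu_ev Y (utriv (dim V)) V (smk (Some (frame V)) (acoord z)).

(** The choice of frame does not matter: O(n) acts on Y(R^n) by evaluation, so a change of frame is
    absorbed by functoriality of [Y]. *)
Lemma counit_acls (V : uob U) n (f : isom (euclid R n) V) (y : Y (utriv n)) :
  counit_fun (acls f (y : beta_obj Y n) : AB V) =
  gu_ev Y (utriv n) V (smk (Some f) y).
Proof.
have e := frame_dim f; subst n.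
rewrite /counit_fun acoord_acls /= /beta_act /= gact1.
rewrite -(@gu_ev_comp R G U Y (utriv (dim V)) (utriv (dim V)) V).
by congr (gu_ev Y _ _ (smk (Some _) _)); apply: isom_eq => v /=; rewrite isomKV.
Qed.

Lemma counit_continuous V : continuous (@counit_fun V).
Proof.
exact: (continuous_cmp (@acoord_continuous R G (beta_obj Y) V)
  (@gu_ev_fun_continuous R G U Y (utriv (dim V)) V (frame V))).
Qed.

Lemma counit_point V : @counit_fun V point = point.
Proof. by rewrite /counit_fun acoord_point smk_ptr bmap_point. Qed.

Definition counit_map V : based_map (AB V) (Y V) :=
  BasedMap (@counit_continuous V) (@counit_point V).

Lemma counit_equiv V g (z : AB V) :
  counit_map V (gact g z) = gact g (counit_map V z).
Proof.
have [y ->] := alphaP z; rewrite /= agact_acls !counit_acls.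
rewrite /= /beta_act /= (@gu_ev_id R G U Y (utriv (dim V))).
(* As G acts trivially on R^n, conjugating the frame by [g] amounts to composing it with
   [rho V g]. *)
rewrite -(@gu_ev_equiv R G U Y (utriv (dim V)) V).
apply: (@gu_ev_eq R G U Y (utriv (dim V)) V) => v /=.
(* Inverses of isometries are obtained by choice, so that of the identity has to be simplified by
   its cancellation law. *)
by congr (rho V g (frame V _)); rewrite -[LHS](isom_invKV (isom_id _)).
Qed.

Lemma counit_ev (V W : uob U) (k : isom V W) (z : AB V) :
  counit_map W (gu_ev AB V W (smk (Some k) z)) =
  gu_ev Y V W (smk (Some k) (counit_map V z)).
Proof.
have [y ->] := alphaP z.
by rewrite /= aev_acls !counit_acls -(@gu_ev_comp R G U Y).
Qed.

Lemma counit_st (V W : uob U) (a : sphere V) (z : AB W) :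
  counit_map (udsum V W) (gu_st AB V W (smk a z)) =
  gu_st Y V W (smk a (counit_map W z)).
Proof.
have [y ->] := alphaP z; have [b ->] := sphere_frame a.
rewrite /= ast_acls !counit_acls.
(* Naturality along the two frames brings the structure map of [Y] back to Euclidean spaces, where
   it defines that of beta up to [isom_row]. *)
rewrite (@gu_st_nat R G U Y (utriv (dim V)) V (utriv (dim W)) W).
rewrite /= /beta_nu_fun -(@gu_ev_comp R G U Y).
apply: gu_ev_eq => v /=.
by rewrite isomK.
Qed.

Definition counit_hom : guspectrum_map AB Y :=
  GUSpectrumMap counit_equiv counit_ev counit_st.

Lemma counit_iso : @iso (guspectra U) AB Y counit_hom.
Proof.
apply: guspectra_iso => V.
(* In the coordinate given by the frame, the counit is evaluation at [frame V]; its inverse is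
   evaluation at the inverse isometry. *)
pose g (y : Y V) : AB V := acls (frame V)
  (gu_ev Y V (utriv (dim V)) (smk (Some (isom_inv (frame V))) y) :
     beta_obj Y (dim V)).
exists g; split.
- exact: (continuous_cmp
    (@gu_ev_fun_continuous R G U Y V (utriv (dim V)) (isom_inv (frame V)))
    (@acls_continuous R G (beta_obj Y) V _ (frame V))).
- move=> z; have [y ->] := alphaP z.
  rewrite /= counit_acls /g -(@gu_ev_comp R G U Y).
  rewrite (_ : isom_comp _ _ = isom_id _); last first.
    by apply: isom_eq => v /=; rewrite isomK.
  by rewrite (@gu_ev_id R G U Y (utriv (dim V))).
- move=> y; rewrite /g /= counit_acls -(@gu_ev_comp R G U Y).
  rewrite (_ : isom_comp _ _ = isom_id _); last first.
    by apply: isom_eq => v /=; rewrite isomKV.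
  by rewrite gu_ev_id.
Qed.

End counit_map.

Lemma counit_natural (X Y : guspectrum U) (f : guspectrum_map X Y) :
  gum_comp (counit_hom Y) (alpha_hom U (beta_hom f)) = gum_comp f (counit_hom X).
Proof.
apply: gum_eq => V z; have [y ->] := alphaP z.
by rewrite /= alpha_hom_acls !counit_acls gum_ev.
Qed.

End counit.

(** * The triangle identities *)

Section triangles.
Variables (R : realType) (G : topGroupType) (U : universe R G).

(** The composite is [f, x] |-> [f, [id, x]] |-> [f o id, x]. *)
Lemma counit_alpha_unit (X : gspectrum R G) :
  gum_comp (counit_hom (alpha_obj X U)) (alpha_hom U (unit_hom U X)) =
  gum_id (alpha_obj X U).
Proof.
apply: gum_eq => V z; have [x ->] := alphaP z.
rewrite /= alpha_hom_acls counit_acls /= aev_acls.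
by congr acls; exact: isom_eq.
Qed.

(** The composite is y |-> [id, y] |-> Y(id) y. *)
Lemma beta_counit_unit (Y : guspectrum U) :
  gsm_comp (beta_hom (counit_hom Y)) (unit_hom U (beta_obj Y)) =
  gsm_id (beta_obj Y).
Proof.
apply: gsm_eq => n y; rewrite /= /unit_fun.
by rewrite (@counit_acls R G U Y (utriv n)) (@gu_ev_id R G U Y (utriv n)).
Qed.

End triangles.

Theorem proposition5p1 (R : realType) (G : topGroupType)
  (HG : compact_lie_group R G) (U : universe R G) :
  adjoint_equivalence (alpha U) (beta U).
Proof.
exists (@NatTrans _ _ (functor_id _) (functor_comp (beta U) (alpha U))
  (@unit_hom R G U) (@unit_natural R G U)).
exists (@NatTrans _ _ (functor_comp (alpha U) (beta U)) (functor_id _)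
  (@counit_hom R G U) (@counit_natural R G U)).
split.
- exact: counit_alpha_unit.
- exact: beta_counit_unit.
- exact: unit_iso.
- exact: counit_iso.
Qed.
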